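(* Let $\mathcal W$ be the collection of incomplete words on random variables, with coproduct $\Delta_{\mathcal W}$, half-unshuffle coproducts $\Delta_\prec,\Delta_\succ$ and reduced coproduct $\bar\Delta_{\mathcal W}=\Delta_\prec+\Delta_\succ$. Then the linear $\mathsf{TW}$-indexed collection $\mathbb C\mathcal W$ equipped with $\Delta_{\mathcal W}$ is an unshuffle conilpotent coaugmented comonoid, by which the following is meant. (1) The morphisms of $\mathsf{TW}$-indexed collections $\varepsilon:\mathbb C\mathcal W\to\mathcal E$ and $\eta:\mathcal E\to\mathbb C\mathcal W$ given by $\varepsilon_{(\alpha,\mathbf 0)}(\alpha)=\ast$ for $\alpha\in\{\mathsf L,\mathsf R\}^\star$, $\varepsilon_t=0$ if $t$ is not of the form $(\alpha,\mathbf 0)$, and $\eta_{(\alpha,\mathbf 0)}(\ast)=\alpha$, satisfy $$(\varepsilon\boxtimes\mathrm{id})\circ\Delta_{\mathcal W}=\mathrm{id},\qquad(\mathrm{id}\boxtimes\varepsilon)\circ\Delta_{\mathcal W}=\mathrm{id},\qquad\varepsilon\circ\eta=\mathrm{id}.$$ (2) For every translucent word $t$ with $b_t\ne\mathbf 0$ and every $w\in\mathcal W(t)$, $$\Delta_{\mathcal W}(w)=w\boxtimes\eta_{(\alpha_t,\mathbf 0)}(\ast)+\eta_{(\alpha_t|_{[t]_0},\mathbf 0)}(\ast)\boxtimes w+\bar\Delta_{\mathcal W}(w).$$ (3) The unshuffle relations hold: $$(\Delta_\prec\boxtimes\mathrm{id})\circ\Delta_\prec=(\mathrm{id}\boxtimes\bar\Delta_{\mathcal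 W})\circ\Delta_\prec,\qquad(\mathrm{id}\boxtimes\Delta_\succ)\circ\Delta_\succ=(\bar\Delta_{\mathcal W}\boxtimes\mathrm{id})\circ\Delta_\succ,\qquad(\Delta_\succ\boxtimes\mathrm{id})\circ\Delta_\prec=(\mathrm{id}\boxtimes\Delta_\prec)\circ\Delta_\succ.$$ (4) $\bar\Delta_{\mathcal W}$ is nilpotent: for every $w\in\mathcal W^+$ there is an $n$ with $\bar\Delta_{\mathcal W}^{\,n}(w)=0$, where $\bar\Delta_{\mathcal W}^{\,1}=\bar\Delta_{\mathcal W}$ and $\bar\Delta_{\mathcal W}^{\,k+1}=(\bar\Delta_{\mathcal W}\boxtimes\mathrm{id})\circ\bar\Delta_{\mathcal W}^{\,k}$.
   Context: Write $\llbracket n\rrbracket=\{1,\dots,n\}$; $A\subset B$ allows equality. For a word $w$ of length $|w|$ over any alphabet and $A=\{i_1<\dots<i_p\}\subset\llbracket|w|\rrbracket$, the restriction is $w|_A=w(i_1)\cdots w(i_p)$. Translucent words. A translucent word is a pair $t=(\alpha_t,b_t)$ of words of equal length $|t|\ge0$, $\alpha_t\in\{\mathsf L,\mathsf R\}^\star$, $b_t\in\{0,1\}^\star$. Put $[t]_0=\{i:b_t(i)=0\}$ and $[t]_1=\{i:b_t(i)=1\}$, $t(i)=(\alpha_t(i),b_t(i))$, $t|_A=(\alpha_t|_A,b_t|_A)$; $\mathbf 0$ is the Boolean word of the appropriate length with only zeros. $\mathsf{TW}$ is the set of translucent words. Set $\mathrm{source}(t)=\alpha_t$, $\mathrm{target}(t)=\alpha_t|_{[t]_0}$.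 If $\mathrm{source}(r)=\mathrm{target}(s)$, the composition $r\circ s$ is the unique translucent word $t$ of length $|s|$ with $t|_{[s]_1}=s|_{[s]_1}$ and $t|_{[s]_0}=r$. Necklace order. For $\alpha\in\{\mathsf L,\mathsf R\}^\star$ of length $n$, the necklace order $\lessdot$ on $\llbracket n\rrbracket$ is the total order in which all positions $i$ with $\alpha(i)=\mathsf L$ precede all positions with $\alpha(i)=\mathsf R$, the $\mathsf L$-positions are ordered increasingly and the $\mathsf R$-positions are ordered decreasingly. For nonempty $A\subset\llbracket n\rrbracket$, $\dot\bigwedge A$ is the $\lessdot$-minimum of $A$. Collections. A linear $\mathsf{TW}$-indexed collection is a family $(\mathcal V(t))_{t\in\mathsf{TW}}$ of complex vector spaces; morphisms are families of linear maps. The vertical composition is $(\mathcal V\boxtimes\mathcal V')(t)=\bigoplus_{t=r\circ s}\mathcal V(r)\otimes\mathcal V'(s)$, a monoidal product with unit $\mathcal E$, $\mathcal E(t)=\mathbb C\ast$ (one-dimensional with basis vector $\ast$) if $b_t=\mathbf 0$ and $\mathcal E(t)=0$ otherwise; $\mathcal E\boxtimes\mathcal V$, $\mathcal V\boxtimes\mathcal E$ are identified with $\mathcal V$, and associators are suppressed. For $x\in\mathcal V(r)$, $y\in\mathcal V'(s)$ with $r,s$ composable one writes $x\boxtimes y$ for $x\otimes y$. Incomplete words. Fix finite sets $\dot S^{\mathsf L}\subset\mathcal A^{\mathsf L}$, $\dot S^{\mathsf R}\subset\mathcal A^{\mathsf R}$ of left and right random variables, where $\mathcal A^{\mathsf L},\mathcal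 A^{\mathsf R}$ are subalgebras of a unital complex algebra (with a unital linear functional, which plays no role here); they are treated as disjoint, and disjoint from the placeholder symbols $\{\mathsf L,\mathsf R\}$. Put $S^{(\mathsf L,0)}=\{\mathsf L\}$, $S^{(\mathsf R,0)}=\{\mathsf R\}$, $S^{(\mathsf L,1)}=\dot S^{\mathsf L}$, $S^{(\mathsf R,1)}=\dot S^{\mathsf R}$ and $\mathcal W(t)=S^{t(1)}\times\cdots\times S^{t(|t|)}$. Elements of $\mathcal W(t)$ are incomplete words of type $t$; $[w]_0=[t]_0$, $[w]_1=[t]_1$ for $w\in\mathcal W(t)$. $\mathbb C\mathcal W(t)$ is the vector space with basis $\mathcal W(t)$. $\mathcal W^+(t)=\mathcal W(t)$ if $b_t\neq\mathbf 0$ and $\varnothing$ otherwise. The translucidation $w_{I\leadsto0}$ of $w$ at $I\subset\llbracket|w|\rrbracket$ is obtained from $w$ by replacing, for each $k\in I$, the letter $w(k)$ by the placeholder $\alpha_t(k)\in\{\mathsf L,\mathsf R\}$. Coproducts. $\Delta_{\mathcal W}:\mathbb C\mathcal W\to\mathbb C\mathcal W\boxtimes\mathbb C\mathcal W$ is $$\Delta_{\mathcal W}(w)=\sum_{[w]_0\subset I\subset\llbracket|w|\rrbracket}w|_I\boxtimes w_{I\leadsto0}.$$ The half-unshuffle coproducts $\Delta_\prec,\Delta_\succ:\mathbb C\mathcal W^+\to\mathbb C\mathcal W^+\boxtimes\mathbb C\mathcal W^+$ are, for $w\in\mathcal W^+$, $$\Delta_\prec(w)=\sum_{\substack{[w]_0\subsetneq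 I\subsetneq\llbracket|w|\rrbracket\\ \dot\bigwedge[w]_1\in I}}w|_I\boxtimes w_{I\leadsto0},\qquad\Delta_\succ(w)=\sum_{\substack{[w]_0\subsetneq I\subsetneq\llbracket|w|\rrbracket\\ \dot\bigwedge[w]_1\notin I}}w|_I\boxtimes w_{I\leadsto0}.$$ *)

(* Defs.v *)
From HB Require Import structures.
From mathcomp Require Import all_boot all_order all_algebra.
From mathcomp Require Import boolp.

Set Implicit Arguments.
Unset Strict Implicit.
Unset Printing Implicit Defensive.

Import GRing.Theory.
Local Open Scope ring_scope.
Local Open Scope quotient_scope.

Section Tensor.
Variables (K : fieldType) (V W : lmodType K).

(* A list [:: (x1, y1); ...; (xn, yn)] stands for x1 (x) y1 + ... + xn (x) yn;
   tens_rel is the congruence generated by the bilinearity relations. *)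
Inductive tens_rel : seq (V * W) -> seq (V * W) -> Prop :=
| tens_refl s : tens_rel s s
| tens_sym s1 s2 : tens_rel s1 s2 -> tens_rel s2 s1
| tens_trans s2 s1 s3 : tens_rel s1 s2 -> tens_rel s2 s3 -> tens_rel s1 s3
| tens_cat s1 s1' s2 s2' :
    tens_rel s1 s1' -> tens_rel s2 s2' -> tens_rel (s1 ++ s2) (s1' ++ s2')
| tens_catC s1 s2 : tens_rel (s1 ++ s2) (s2 ++ s1)
| tens_addl x x' y : tens_rel [:: (x + x', y)] [:: (x, y); (x', y)]
| tens_addr x y y' : tens_rel [:: (x, y + y')] [:: (x, y); (x, y')]
| tens_scale a x y : tens_rel [:: (a *: x, y)] [:: (x, a *: y)]
| tens_zero y : tens_rel [:: (0, y)] [::].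

Definition tens_relb (s1 s2 : seq (V * W)) : bool := `[< tens_rel s1 s2 >].

Lemma tens_relb_equiv : equiv_class_of tens_relb.
Proof.
split=> [s|s1 s2|s2 s1 s3].
- by apply/asboolP; exact: tens_refl.
- by apply/idP/idP => /asboolP h; apply/asboolP; exact: tens_sym.
- move=> /asboolP h1 /asboolP h2; apply/asboolP; exact: tens_trans h1 h2.
Qed.

Canonical tens_equiv := EquivRelPack tens_relb_equiv.

Definition tensor := {eq_quot tens_relb}.

HB.instance Definition _ := Choice.on tensor.

Definition tens_of (s : seq (V * W)) : tensor := \pi_tensor s.

Lemma tens_ofP s1 s2 : tens_of s1 = tens_of s2 <-> tens_rel s1 s2.
Proof.
split=> [/eqquotP h|h]; first exact/asboolP.
by apply/eqquotP; apply/asboolP.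
Qed.

Lemma tens_of_repr (u : tensor) : tens_of (repr u) = u.
Proof. exact: reprK. Qed.

Lemma tens_repr_rel s : tens_rel (repr (tens_of s)) s.
Proof. by apply/tens_ofP; rewrite tens_of_repr. Qed.

Definition tens_scl (a : K) (s : seq (V * W)) := [seq (a *: p.1, p.2) | p <- s].

Lemma tens_scl_rel a s1 s2 :
  tens_rel s1 s2 -> tens_rel (tens_scl a s1) (tens_scl a s2).
Proof.
elim=> {s1 s2}.
- by move=> s; exact: tens_refl.
- by move=> s1 s2 _; exact: tens_sym.
- by move=> s2 s1 s3 _ h1 _; exact: tens_trans.
- by move=> s1 s1' s2 s2' _ h1 _ h2; rewrite /tens_scl !map_cat; exact: tens_cat.
- by move=> s1 s2; rewrite /tens_scl !map_cat; exact: tens_catC.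
- by move=> x x' y /=; rewrite scalerDr; exact: tens_addl.
- by move=> x y y' /=; exact: tens_addr.
- by move=> b x y /=; rewrite scalerA mulrC -scalerA; exact: tens_scale.
- by move=> y /=; rewrite scaler0; exact: tens_zero.
Qed.

Definition tens0 : tensor := tens_of [::].
Definition tens_add (u v : tensor) : tensor := tens_of (repr u ++ repr v).
Definition tens_scalar (a : K) (u : tensor) : tensor := tens_of (tens_scl a (repr u)).
Definition tens_opp (u : tensor) : tensor := tens_scalar (-1) u.

Lemma tens_add_of s1 s2 : tens_add (tens_of s1) (tens_of s2) = tens_of (s1 ++ s2).
Proof. by apply/tens_ofP; apply: tens_cat; exact: tens_repr_rel. Qed.

Lemma tens_scalar_of a s : tens_scalar a (tens_of s) = tens_of (tens_scl a s).
Proof. by apply/tens_ofP; apply: tens_scl_rel; exact: tens_repr_rel. Qed.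

Lemma tens_addA : associative tens_add.
Proof.
move=> u v w; rewrite -[u]tens_of_repr -[v]tens_of_repr -[w]tens_of_repr.
by rewrite !tens_add_of catA.
Qed.

Lemma tens_addC : commutative tens_add.
Proof. by move=> u v; apply/tens_ofP; exact: tens_catC. Qed.

Lemma tens_add0 : left_id tens0 tens_add.
Proof. by move=> u; rewrite -[u]tens_of_repr tens_add_of. Qed.

Lemma tens_shuffle p q (A B : seq (V * W)) :
  tens_rel ((p :: A) ++ (q :: B)) ([:: p; q] ++ (A ++ B)).
Proof.
apply: (@tens_trans ([:: p] ++ ((A ++ [:: q]) ++ B))).
  rewrite -catA; exact: tens_refl.
apply: (@tens_trans ([:: p] ++ (([:: q] ++ A) ++ B))); last exact: tens_refl.
apply: tens_cat; first exact: tens_refl.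
by apply: tens_cat (tens_refl _); exact: tens_catC.
Qed.

Lemma tens_cancel a b s :
  tens_rel (tens_scl a s ++ tens_scl b s) (tens_scl (a + b) s).
Proof.
elim: s => [|[x y] s IH]; first exact: tens_refl.
apply: tens_trans (tens_shuffle _ _ _ _) _.
apply: (@tens_trans ([:: ((a + b) *: x, y)] ++ tens_scl (a + b) s)); last exact: tens_refl.
by apply: tens_cat IH; rewrite /= scalerDl; apply: tens_sym; exact: tens_addl.
Qed.

Lemma tens_scl0 s : tens_rel (tens_scl 0 s) [::].
Proof.
elim: s => [|[x y] s IH] /=; first exact: tens_refl.
rewrite scale0r -cat1s -[[::]]cat0s; apply: tens_cat IH; exact: tens_zero.
Qed.

Lemma tens_scl1 s : tens_scl 1 s = s.
Proof. by elim: s => [|[x y] s IH] //=; rewrite scale1r IH. Qed.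

Lemma tens_addN : left_inverse tens0 tens_opp tens_add.
Proof.
move=> u; rewrite -[u]tens_of_repr /tens_opp tens_scalar_of tens_add_of.
apply/tens_ofP; rewrite -{2}[repr u]tens_scl1.
by apply: tens_trans (tens_cancel _ _ _) _; rewrite addNr; exact: tens_scl0.
Qed.

HB.instance Definition _ :=
  GRing.isZmodule.Build tensor tens_addA tens_addC tens_add0 tens_addN.

Lemma tens_scalarA a b u : tens_scalar a (tens_scalar b u) = tens_scalar (a * b) u.
Proof.
rewrite -[u]tens_of_repr !tens_scalar_of; congr tens_of.
by rewrite /tens_scl -map_comp; apply: eq_map => p /=; rewrite scalerA.
Qed.

Lemma tens_scalar1 : left_id 1 tens_scalar.
Proof. by move=> u; rewrite -[u]tens_of_repr tens_scalar_of tens_scl1. Qed.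

Lemma tens_scalarDr : right_distributive tens_scalar +%R.
Proof.
move=> a u v; rewrite -[u]tens_of_repr -[v]tens_of_repr.
rewrite /GRing.add /= tens_add_of !tens_scalar_of tens_add_of.
by rewrite /tens_scl map_cat.
Qed.

Lemma tens_scalarDl u : {morph tens_scalar^~ u : a b / a + b}.
Proof.
move=> a b; rewrite -[u]tens_of_repr !tens_scalar_of.
rewrite {2}/GRing.add /= tens_add_of; apply/tens_ofP; apply: tens_sym.
exact: tens_cancel.
Qed.

HB.instance Definition _ := GRing.Zmodule_isLmodule.Build K tensor
  tens_scalarA tens_scalar1 tens_scalarDr tens_scalarDl.

Definition ten (x : V) (y : W) : tensor := tens_of [:: (x, y)].

Lemma tenDl x x' y : ten (x + x') y = ten x y + ten x' y.
Proof.
by rewrite {2}/GRing.add /= tens_add_of; apply/tens_ofP; exact: tens_addl.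
Qed.

Lemma tenDr x y y' : ten x (y + y') = ten x y + ten x y'.
Proof.
by rewrite {2}/GRing.add /= tens_add_of; apply/tens_ofP; exact: tens_addr.
Qed.

Lemma tenZl a x y : ten (a *: x) y = a *: ten x y.
Proof. by rewrite {2}/GRing.scale /= tens_scalar_of. Qed.

Lemma tenZr a x y : ten x (a *: y) = a *: ten x y.
Proof. by rewrite -tenZl; apply/tens_ofP; apply: tens_sym; exact: tens_scale. Qed.

Lemma ten_bilinear : bilinear_for *:%R *:%R ten.
Proof.
split=> [y a x x'|x a y y'] /=; first by rewrite tenDl tenZl.
by rewrite tenDr tenZr.
Qed.

Lemma tensorE (u : tensor) : u = \sum_(p <- repr u) ten p.1 p.2.
Proof.
rewrite -{1}[u]tens_of_repr; elim: (repr u) => [|[x y] s IH].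
  by rewrite big_nil.
by rewrite big_cons -IH /GRing.add /= tens_add_of.
Qed.

Section Lift.
Variables (U : lmodType K) (f : V -> W -> U).

Definition tlift (u : tensor) : U := \sum_(p <- repr u) f p.1 p.2.

Hypothesis fP : bilinear_for *:%R *:%R f.

Lemma bilDl x x' y : f (x + x') y = f x y + f x' y.
Proof. by case: fP => h _; move: (h y 1 x x') => /=; rewrite !scale1r. Qed.
Lemma bil0l y : f 0 y = 0.
Proof. by apply: (addrI (f 0 y)); rewrite -bilDl !addr0. Qed.
Lemma bilZl a x y : f (a *: x) y = a *: f x y.
Proof. by case: fP => h _; move: (h y a x 0) => /=; rewrite addr0 bil0l addr0. Qed.
Lemma bilDr x y y' : f x (y + y') = f x y + f x y'.
Proof. by case: fP => _ h; move: (h x 1 y y') => /=; rewrite !scale1r. Qed.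
Lemma bil0r x : f x 0 = 0.
Proof. by apply: (addrI (f x 0)); rewrite -bilDr !addr0. Qed.
Lemma bilZr a x y : f x (a *: y) = a *: f x y.
Proof. by case: fP => _ h; move: (h x a y 0) => /=; rewrite addr0 bil0r addr0. Qed.

Lemma tlift_rel s1 s2 : tens_rel s1 s2 ->
  \sum_(p <- s1) f p.1 p.2 = \sum_(p <- s2) f p.1 p.2.
Proof.
elim=> {s1 s2} //.
- by move=> s2 s1 s3 _ e1 _ e2; rewrite e1 e2.
- by move=> s1 s1' s2 s2' _ h1 _ h2; rewrite !big_cat /= h1 h2.
- by move=> s1 s2; rewrite !big_cat /= addrC.
- by move=> x x' y; rewrite !big_cons !big_nil /= bilDl !addr0.
- by move=> x y y'; rewrite !big_cons !big_nil /= bilDr !addr0.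
- by move=> a x y; rewrite !big_cons !big_nil /= bilZl bilZr.
- by move=> y; rewrite !big_cons !big_nil /= bil0l addr0.
Qed.

Lemma tlift_of s : tlift (tens_of s) = \sum_(p <- s) f p.1 p.2.
Proof. exact: tlift_rel (tens_repr_rel s). Qed.

Lemma tlift_ten x y : tlift (ten x y) = f x y.
Proof. by rewrite tlift_of big_seq1. Qed.

Lemma tlift0 : tlift 0 = 0.
Proof. by rewrite -[0 in LHS]/(tens_of [::]) tlift_of big_nil. Qed.

Lemma tlift_linear : linear tlift.
Proof.
move=> a u v; rewrite -[u]tens_of_repr -[v]tens_of_repr.
rewrite {1}/GRing.scale /= tens_scalar_of {1}/GRing.add /= tens_add_of !tlift_of.
rewrite big_cat /= big_map scaler_sumr; congr (_ + _).
by apply: eq_bigr => p _ /=; rewrite bilZl.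
Qed.

End Lift.

End Tensor.

Section DirectSum.
Variables (K : fieldType) (I : finType) (V : I -> lmodType K).

Definition dsum := {dffun forall i : I, V i}.

HB.instance Definition _ := Choice.on dsum.

Implicit Types u v w : dsum.

Definition dsum0 : dsum := [ffun i => 0 : V i].
Definition dsum_opp u : dsum := [ffun i => - u i : V i].
Definition dsum_add u v : dsum := [ffun i => u i + v i : V i].
Definition dsum_scale (a : K) u : dsum := [ffun i => a *: u i : V i].

Lemma dsum_addA : associative dsum_add.
Proof. by move=> u v w; apply/ffunP => i; rewrite !ffunE addrA. Qed.
Lemma dsum_addC : commutative dsum_add.
Proof. by move=> u v; apply/ffunP => i; rewrite !ffunE addrC. Qed.
Lemma dsum_add0 : left_id dsum0 dsum_add.
Proof. by move=> u; apply/ffunP => i; rewrite !ffunE add0r. Qed.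
Lemma dsum_addN : left_inverse dsum0 dsum_opp dsum_add.
Proof. by move=> u; apply/ffunP => i; rewrite !ffunE addNr. Qed.

HB.instance Definition _ :=
  GRing.isZmodule.Build dsum dsum_addA dsum_addC dsum_add0 dsum_addN.

Lemma dsum_scaleA a b u : dsum_scale a (dsum_scale b u) = dsum_scale (a * b) u.
Proof. by apply/ffunP => i; rewrite !ffunE scalerA. Qed.
Lemma dsum_scale1 : left_id 1 dsum_scale.
Proof. by move=> u; apply/ffunP => i; rewrite !ffunE scale1r. Qed.
Lemma dsum_scaleDr : right_distributive dsum_scale +%R.
Proof. by move=> a u v; apply/ffunP => i; rewrite !ffunE scalerDr. Qed.
Lemma dsum_scaleDl u : {morph dsum_scale^~ u : a b / a + b}.
Proof. by move=> a b; apply/ffunP => i; rewrite !ffunE scalerDl. Qed.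

HB.instance Definition _ := GRing.Zmodule_isLmodule.Build K dsum
  dsum_scaleA dsum_scale1 dsum_scaleDr dsum_scaleDl.

Lemma dsumDE u v i : (u + v) i = u i + v i. Proof. by rewrite ffunE. Qed.
Lemma dsumZE a u i : (a *: u) i = a *: u i. Proof. by rewrite ffunE. Qed.
Lemma dsum0E i : (0 : dsum) i = 0. Proof. by rewrite ffunE. Qed.

Lemma dsum_sumE (J : Type) (r : seq J) (P : pred J) (F : J -> dsum) i :
  (\sum_(j <- r | P j) F j) i = \sum_(j <- r | P j) F j i.
Proof.
elim/big_rec2: _ => [|j x y _ <-]; first by rewrite dsum0E.
by rewrite dsumDE.
Qed.

Definition dinj (i : I) (x : V i) : dsum :=
  [ffun j => if @eqP _ i j is ReflectT e then ecast k (V k) e x else 0 : V j].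

Lemma dinjE i (x : V i) : dinj x i = x.
Proof. by rewrite ffunE; case: eqP => // e; rewrite eq_axiomK. Qed.

Lemma dinj_neq i j (x : V i) : i != j -> dinj x j = 0.
Proof. by rewrite ffunE; case: eqP. Qed.

Lemma dinj_linear i : linear (@dinj i).
Proof.
move=> a x y; apply/ffunP => j; rewrite !ffunE; case: eqP => [e|_].
  by case: j / e.
by rewrite scaler0 addr0.
Qed.

HB.instance Definition _ i :=
  GRing.isLinear.Build K (V i) dsum _ (@dinj i) (@dinj_linear i).

Lemma dsum_decomp u : u = \sum_i dinj (u i).
Proof.
apply/ffunP => j; rewrite dsum_sumE (bigD1 j) //= dinjE big1 ?addr0 // => i ij.
exact: dinj_neq.
Qed.

End DirectSum.

Section Free.
Variables (K : fieldType) (X : finType).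

Definition freesp : lmodType K := {ffun X -> K^o}.

Definition bvec (x : X) : freesp := [ffun y => (y == x)%:R].

Lemma free_decomp (v : freesp) : v = \sum_x v x *: bvec x.
Proof.
apply/ffunP => y; rewrite sum_ffunE (bigD1 y) //= !ffunE eqxx.
rewrite big1 ?addr0 => [|x xy]; first by rewrite /GRing.scale /= mulr1.
by rewrite !ffunE eq_sym (negbTE xy) scaler0.
Qed.

Section Ext.
Variables (U : lmodType K) (f : X -> U).

Definition lext (v : freesp) : U := \sum_x v x *: f x.

Lemma lext_linear : linear lext.
Proof.
move=> a u v; rewrite /lext scaler_sumr -big_split; apply: eq_bigr => x _ /=.
by rewrite !ffunE scalerDl scalerA.
Qed.

HB.instance Definition _ := GRing.isLinear.Build K freesp U _ lext lext_linear.

Lemma lext_bvec x : lext (bvec x) = f x.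
Proof.
rewrite /lext (bigD1 x) //= ffunE eqxx scale1r big1 ?addr0 // => y yx.
by rewrite ffunE (negbTE yx) scale0r.
Qed.

End Ext.
End Free.

Inductive side := sideL | sideR.

Definition side_to_bool (a : side) := if a is sideL then true else false.
Definition bool_to_side (b : bool) := if b then sideL else sideR.
Lemma side_boolK : cancel side_to_bool bool_to_side.
Proof. by case. Qed.
HB.instance Definition _ := Finite.copy side (can_type side_boolK).

(* The pair of words (alpha_t, b_t) is stored as the word of pairs
   t(i) = (alpha_t(i), b_t(i)); the Boolean 1 is true. *)
Definition tword := seq (side * bool).

(* w|_A, where w has length n; positions are numbered from 0. *)
Definition restr T n (A : {set 'I_n}) (w : seq T) : seq T :=
  mask [seq i \in A | i <- enum 'I_n] w.

Definition zeros (t : tword) : {set 'I_(size t)} :=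
  [set i | ~~ (tnth (in_tuple t) i).2].
Definition ones (t : tword) : {set 'I_(size t)} :=
  [set i | (tnth (in_tuple t) i).2].

Definition source (t : tword) : seq side := [seq x.1 | x <- t].
Definition target (t : tword) : seq side := restr (zeros t) (source t).
Definition allzero (t : tword) : bool := all (fun x => ~~ x.2) t.
Definition zword (alpha : seq side) : tword := [seq (a, false) | a <- alpha].

(* r o s, of interest only when source r = target s, see compP. *)
Fixpoint tcomp (r s : tword) : tword :=
  match s, r with
  | (a, true) :: s', _ => (a, true) :: tcomp r s'
  | (a, false) :: s', x :: r' => x :: tcomp r' s'
  | _, _ => s
  end.

Definition is_comp (r s t : tword) : bool :=
  (source r == target s) && (tcomp r s == t).

Lemma mask_enum T (s : seq T) (p : pred T) :
  [seq p (tnth (in_tuple s) i) | i <- enum 'I_(size s)] = map p s.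
Proof.
rewrite (map_comp p) -[RHS]/(map p (in_tuple s)); congr map.
exact: (map_tnth_enum (in_tuple s)).
Qed.

Lemma restr_mask T (t : tword) (p : pred (side * bool)) (w : seq T) :
  restr [set i | p (tnth (in_tuple t) i)] w = mask (map p t) w.
Proof. by rewrite /restr -(mask_enum t p); congr mask; apply: eq_map => i; rewrite inE. Qed.

Lemma targetE t : target t = source [seq x <- t | ~~ x.2].
Proof. by rewrite /target (@restr_mask _ t (fun x => ~~ x.2)) filter_mask -map_mask. Qed.

Lemma target_nil : target [::] = [::].
Proof. by rewrite targetE. Qed.

Lemma target_cons x t :
  target (x :: t) = if x.2 then target t else x.1 :: target t.
Proof. by rewrite !targetE /=; case: x => a []. Qed.

Lemma source_cons x t : source (x :: t) = x.1 :: source t.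
Proof. by []. Qed.

Lemma source_comp r s : source r = target s -> source (tcomp r s) = source s.
Proof.
rewrite /source; elim: s r => [|[a []] s IH] r; first by case: r.
  by rewrite target_cons /= => /IH ->.
by rewrite target_cons; case: r => [|x r] //= [-> /IH ->].
Qed.

Lemma target_comp r s : source r = target s -> target (tcomp r s) = target r.
Proof.
elim: s r => [|[a []] s IH] r; first by rewrite target_nil; case: r => [|x r] //=; rewrite target_nil.
  by rewrite target_cons /= => e; rewrite target_cons /= IH.
by rewrite target_cons; case: r => [|x r] //= [_ e]; rewrite !target_cons IH.
Qed.

Lemma compA p r s : source p = target r -> source r = target s ->
  tcomp p (tcomp r s) = tcomp (tcomp p r) s.
Proof.
elim: s r p => [|[a []] s IH] r p.
- by rewrite target_nil; case: r => [|x r] //=; rewrite target_nil; case: p => [|y p] //=.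
- by rewrite target_cons /= => pr rs; rewrite IH.
rewrite [target (_ :: s)]target_cons; case: r => [|[b c] r] //= + [ba rs].
rewrite target_cons; case: c => /= pr; first by rewrite IH.
by case: p pr => [|x p] //= [_ pr]; rewrite IH.
Qed.

(* tcomp r s is the only translucent word of length |s| that agrees with s
   on [s]_1 and restricts to r on [s]_0. *)
Lemma compP r s t : source r = target s ->
  tcomp r s = t <->
  [/\ size t = size s, restr (ones s) t = restr (ones s) s
    & restr (zeros s) t = r].
Proof.
move=> rs; rewrite !(@restr_mask _ s snd) !(@restr_mask _ s (fun x => ~~ x.2)).
elim: s r t rs => [|[a []] s IH] r t.
- rewrite target_nil; by case: r t => [|x r] [|y t] //= _; split=> [//|[]].
- rewrite target_cons /= => rs; case: t => [|y t] /=; first by split=> [|[]].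
  split=> [[<-] /(IH _ _ rs)[-> -> ->] //|[[st] [-> et] er]].
  by congr cons; apply/(IH _ _ rs).
rewrite target_cons; case: r => [|x r] //= [_ rs].
case: t => [|y t] /=; first by split=> [|[]].
split=> [[<-] /(IH _ _ rs)[-> -> ->] //|[[st] et [-> er]]].
by congr cons; apply/(IH _ _ rs).
Qed.

Lemma source_zword alpha : source (zword alpha) = alpha.
Proof. by rewrite /source -map_comp map_id. Qed.

Lemma allzero_zword alpha : allzero (zword alpha).
Proof. by rewrite /allzero all_map; apply/allP. Qed.

Lemma allzeroE t : allzero t -> t = zword (source t).
Proof.
by rewrite /zword /source -map_comp; elim: t => [|[a []] t IH] //= /IH {1}->.
Qed.

Lemma target_zword alpha : target (zword alpha) = alpha.
Proof. by rewrite targetE -[RHS]source_zword (all_filterP (allzero_zword _)). Qed.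

Lemma comp_zwordl t : tcomp (zword (target t)) t = t.
Proof. by elim: t => [|[a []] t IH] //; rewrite target_cons /= IH. Qed.

Lemma comp_zwordr t : tcomp t (zword (source t)) = t.
Proof. by elim: t => [|[a b] t IH] //=; rewrite IH. Qed.

Lemma is_comp_zwordl t : is_comp (zword (target t)) t t.
Proof. by rewrite /is_comp source_zword comp_zwordl !eqxx. Qed.

Lemma is_comp_zwordr t : is_comp t (zword (source t)) t.
Proof. by rewrite /is_comp target_zword comp_zwordr !eqxx. Qed.

Definition factn (t : tword) := {p : tword * tword | is_comp p.1 p.2 t}.
HB.instance Definition _ t := Countable.on (factn t).

Lemma factn_size1 t (p : factn t) : (size (val p).1 <= size t)%N.
Proof.
case: p => -[r s] /= /andP[/eqP rs /eqP <-].
rewrite -(size_map fst r) -/(source r) rs -(size_map fst (tcomp r s)).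
rewrite -/(source _) source_comp // targetE !size_map size_filter; exact: count_size.
Qed.

Lemma factn_size2 t (p : factn t) : (size (val p).2 <= size t)%N.
Proof.
case: p => -[r s] /= /andP[/eqP rs /eqP <-].
by rewrite -(size_map fst s) -(size_map fst (tcomp r s)) -!/(source _) source_comp.
Qed.

Definition factn_code t (p : factn t) :
    (size t).-bseq (side * bool) * (size t).-bseq (side * bool) :=
  (Bseq (factn_size1 p), Bseq (factn_size2 p)).
Definition factn_decode t
    (q : (size t).-bseq (side * bool) * (size t).-bseq (side * bool)) :
  option (factn t) := insub (val q.1, val q.2).
Lemma factn_codeK t : pcancel (@factn_code t) (@factn_decode t).
Proof. by case=> -[r s] h; rewrite /factn_decode /= insubT. Qed.
HB.instance Definition _ t : isFinite (factn t) := PCanIsFinite (@factn_codeK t).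

Section Collections.
Variable K : fieldType.

Definition collection := tword -> lmodType K.
Implicit Types V : collection.

Definition mor V1 V2 := forall t, {linear V1 t -> V2 t}.
Definition mor_eq V1 V2 (f g : mor V1 V2) := forall t, f t =1 g t.
Definition mor_id V : mor V V := fun t => idfun.
Definition mor_comp V1 V2 V3 (g : mor V2 V3) (f : mor V1 V2) : mor V1 V3 :=
  fun t => g t \o f t.
Definition mor_add V1 V2 (f g : mor V1 V2) : mor V1 V2 := fun t => f t \+ g t.

Definition box V1 V2 : collection :=
  fun t => dsum (fun p : factn t => tensor (V1 (val p).1) (V2 (val p).2)).

Section Box.
Variables (V1 V2 : collection) (t : tword).

(* x (x) y in the summand V1 r (x) V2 s indexed by the factorisation t = r o s *)
Definition bten r s (h : is_comp r s t) (x : V1 r) (y : V2 s) : box V1 V2 t :=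
  @dinj _ _ (fun p : factn t => tensor (V1 (val p).1) (V2 (val p).2))
    (exist _ (r, s) h) (ten x y).

Lemma bten_bilinear r s (h : is_comp r s t) :
  bilinear_for *:%R *:%R (@bten r s h).
Proof.
split=> [y a x x'|x a y y'] /=; rewrite /bten -dinj_linear.
  by rewrite tenDl tenZl.
by rewrite tenDr tenZr.
Qed.

Lemma box_ind (P : box V1 V2 t -> Prop) :
  P 0 -> (forall u v, P u -> P v -> P (u + v)) ->
  (forall r s (h : is_comp r s t) x y, P (bten h x y)) -> forall u, P u.
Proof.
move=> P0 PD Pb u; rewrite [u]dsum_decomp; apply: big_ind => // -[[r s] h] _.
rewrite [u _]tensorE linear_sum; apply: big_ind => // q _; exact: Pb.
Qed.

Lemma box_ext (U : lmodType K) (f g : {linear box V1 V2 t -> U}) :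
  (forall r s (h : is_comp r s t) x y, f (bten h x y) = g (bten h x y)) ->
  f =1 g.
Proof.
move=> fg; apply: box_ind => //; first by rewrite !linear0.
by move=> u v fu fv; rewrite !linearD fu fv.
Qed.

Section Lift.
Variables (U : lmodType K) (f : forall r s, is_comp r s t -> V1 r -> V2 s -> U).

Definition blift (u : box V1 V2 t) : U :=
  \sum_(p : factn t) tlift (f (proj2_sig p)) (u p).

Hypothesis fP : forall r s h, bilinear_for *:%R *:%R (@f r s h).

Lemma blift_linear : linear blift.
Proof.
move=> a u v; rewrite /blift scaler_sumr -big_split; apply: eq_bigr => p _ /=.
by rewrite dsumDE dsumZE tlift_linear.
Qed.

Lemma blift0 : blift 0 = 0.
Proof.
apply: big1 => p _; rewrite dsum0E; apply: tlift0; exact: fP.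
Qed.

Lemma blift_bten r s (h : is_comp r s t) x y : blift (bten h x y) = f h x y.
Proof.
rewrite /blift (bigD1 (exist _ (r, s) h : factn t)) //= /bten dinjE tlift_ten //.
rewrite big1 ?addr0 // => p pE; rewrite dinj_neq 1?eq_sym //.
exact: tlift0.
Qed.

End Lift.
End Box.

Section Map.
Variables (V1 V2 V1' V2' : collection) (f : mor V1 V1') (g : mor V2 V2').

Definition bmap_fun t : box V1 V2 t -> box V1' V2' t :=
  blift (fun r s h x y => bten h (f r x) (g s y)).

Lemma bmap_bil t r s (h : is_comp r s t) :
  bilinear_for *:%R *:%R (fun x y => bten h (f r x) (g s y)).
Proof.
split=> [y a x x'|x a y y'] /=; rewrite linearP.
  by case: (bten_bilinear V1' V2' h) => + _; exact.
by case: (bten_bilinear V1' V2' h) => _; exact.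
Qed.

HB.instance Definition _ t :=
  GRing.isLinear.Build K _ _ _ (@bmap_fun t) (blift_linear (@bmap_bil t)).

Definition bmap : mor (box V1 V2) (box V1' V2') := fun t => @bmap_fun t.

Lemma bmap_bten t r s (h : is_comp r s t) x y :
  bmap t (bten h x y) = bten h (f r x) (g s y).
Proof. exact: blift_bten (@bmap_bil t) _ _ _ _ _. Qed.

End Map.

Section Associator.
Variables (V1 V2 V3 : collection).

Lemma is_comp_r q r s p t :
  is_comp r s t -> is_comp p q r -> is_comp q s (tcomp q s).
Proof.
move=> /andP[/eqP rs _] /andP[/eqP pq /eqP qE].
by rewrite /is_comp -rs -qE source_comp ?eqxx.
Qed.

Lemma is_comp_a r s t p q :
  is_comp r s t -> is_comp p q r -> is_comp p (tcomp q s) t.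
Proof.
move=> /andP[/eqP rs /eqP tE] /andP[/eqP pq /eqP qE]; rewrite /is_comp.
have qs : source q = target s by rewrite -rs -qE source_comp.
by rewrite target_comp // pq eqxx compA // qE tE eqxx.
Qed.

Definition assoc_in t r s (h : is_comp r s t) (u : box V1 V2 r) (z : V3 s) :
    box V1 (box V2 V3) t :=
  blift (fun p q (h' : is_comp p q r) x y =>
           bten (is_comp_a h h') x (bten (is_comp_r h h') y z)) u.

Definition assoc_fun t : box (box V1 V2) V3 t -> box V1 (box V2 V3) t :=
  blift (@assoc_in t).

Lemma assoc_in_bil t r s (h : is_comp r s t) (z : V3 s) p q (h' : is_comp p q r) :
  bilinear_for *:%R *:%R (fun x y =>
    bten (is_comp_a h h') x (bten (is_comp_r h h') y z) : box V1 (box V2 V3) t).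
Proof.
case: (bten_bilinear V1 (box V2 V3) (is_comp_a h h')) => bl br.
case: (bten_bilinear V2 V3 (is_comp_r h h')) => bl' br'.
by split=> [y a x x'|x a y y'] /=; [exact: bl | rewrite bl' br].
Qed.

Lemma assoc_bil t r s (h : is_comp r s t) : bilinear_for *:%R *:%R (@assoc_in t r s h).
Proof.
split=> [z a u u'|u a z z']; first exact: (blift_linear (assoc_in_bil h z)).
rewrite /= /assoc_in /blift scaler_sumr -big_split; apply: eq_bigr => p _ /=.
rewrite /tlift scaler_sumr -big_split; apply: eq_bigr => -[x y] _ /=.
case: (bten_bilinear V2 V3 (is_comp_r h (proj2_sig p))) => _ br'; rewrite br'.
by case: (bten_bilinear V1 (box V2 V3) (is_comp_a h (proj2_sig p))) => _; exact.
Qed.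

HB.instance Definition _ t :=
  GRing.isLinear.Build K _ _ _ (@assoc_fun t) (blift_linear (@assoc_bil t)).

(* (x (x) y) (x) z |-> x (x) (y (x) z), with inverse assocV; see assocK. *)
Definition assoc : mor (box (box V1 V2) V3) (box V1 (box V2 V3)) :=
  fun t => @assoc_fun t.

Lemma assoc_bten t r s (h : is_comp r s t) p q (h' : is_comp p q r) x y z :
  assoc t (bten h (bten h' x y : box V1 V2 r) z) =
  bten (is_comp_a h h') x (bten (is_comp_r h h') y z).
Proof.
rewrite [LHS](blift_bten (@assoc_bil t)).
exact: (blift_bten (@assoc_in_bil t r s h z)).
Qed.

Lemma is_comp_l p q r s t :
  is_comp p s t -> is_comp q r s -> is_comp p q (tcomp p q).
Proof.
move=> /andP[/eqP ps _] /andP[/eqP qr /eqP qE].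
by rewrite /is_comp ps -qE target_comp ?eqxx.
Qed.

Lemma is_comp_aV p s t q r :
  is_comp p s t -> is_comp q r s -> is_comp (tcomp p q) r t.
Proof.
move=> /andP[/eqP ps /eqP tE] /andP[/eqP qr /eqP qE]; rewrite /is_comp.
have pq : source p = target q by rewrite ps -qE target_comp.
by rewrite source_comp // qr eqxx -compA // qE tE eqxx.
Qed.

Definition assocV_in t p s (h : is_comp p s t) (x : V1 p) (u : box V2 V3 s) :
    box (box V1 V2) V3 t :=
  blift (fun q r (h' : is_comp q r s) y z =>
           bten (is_comp_aV h h') (bten (is_comp_l h h') x y : box V1 V2 _) z) u.

Definition assocV_fun t : box V1 (box V2 V3) t -> box (box V1 V2) V3 t :=
  blift (@assocV_in t).

Lemma assocV_in_bil t p s (h : is_comp p s t) (x : V1 p) q r (h' : is_comp q r s) :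
  bilinear_for *:%R *:%R (fun y z =>
    bten (is_comp_aV h h') (bten (is_comp_l h h') x y) z : box (box V1 V2) V3 t).
Proof.
case: (bten_bilinear (box V1 V2) V3 (is_comp_aV h h')) => bl br.
case: (bten_bilinear V1 V2 (is_comp_l h h')) => bl' br'.
by split=> [z a y y'|y a z z'] /=; [rewrite br' bl | exact: br].
Qed.

Lemma assocV_bil t p s (h : is_comp p s t) :
  bilinear_for *:%R *:%R (@assocV_in t p s h).
Proof.
split=> [u a x x'|x a u u']; last exact: (blift_linear (assocV_in_bil h x)).
rewrite /= /assocV_in /blift scaler_sumr -big_split; apply: eq_bigr => f _ /=.
rewrite /tlift scaler_sumr -big_split; apply: eq_bigr => -[y z] _ /=.
case: (bten_bilinear V1 V2 (is_comp_l h (proj2_sig f))) => bl' _; rewrite bl'.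
by case: (bten_bilinear (box V1 V2) V3 (is_comp_aV h (proj2_sig f))) => + _; exact.
Qed.

HB.instance Definition _ t :=
  GRing.isLinear.Build K _ _ _ (@assocV_fun t) (blift_linear (@assocV_bil t)).

Definition assocV : mor (box V1 (box V2 V3)) (box (box V1 V2) V3) :=
  fun t => @assocV_fun t.

Lemma assocV_bten t p s (h : is_comp p s t) q r (h' : is_comp q r s) x y z :
  assocV t (bten h x (bten h' y z : box V2 V3 s)) =
  bten (is_comp_aV h h') (bten (is_comp_l h h') x y) z.
Proof.
rewrite [LHS](blift_bten (@assocV_bil t)).
exact: (blift_bten (@assocV_in_bil t p s h x)).
Qed.

Lemma assocK t : cancel (assoc t) (assocV t).
Proof.
apply: box_ind => [|u v eu ev|r s h u z]; first by rewrite !linear0.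
  by rewrite !linearD eu ev.
case: (bten_bilinear (box V1 V2) V3 h) => bl _.
elim/box_ind: u => [|u v eu ev|p q h' x y].
- by rewrite (bil0l (bten_bilinear _ _ h)) !linear0.
- by rewrite (bilDl (bten_bilinear _ _ h)) !linearD eu ev.
rewrite assoc_bten assocV_bten; have /andP[_ /eqP e] := h'; subst r.
by congr bten; [exact: bool_irrelevance | congr bten; exact: bool_irrelevance].
Qed.

Lemma assocVK t : cancel (assocV t) (assoc t).
Proof.
apply: box_ind => [|u v eu ev|p s h x u]; first by rewrite !linear0.
  by rewrite !linearD eu ev.
elim/box_ind: u => [|u v eu ev|q r h' y z].
- by rewrite (bil0r (bten_bilinear _ _ h)) !linear0.
- by rewrite (bilDr (bten_bilinear _ _ h)) !linearD eu ev.
rewrite assocV_bten assoc_bten; have /andP[_ /eqP e] := h'; subst s.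
by congr bten; [exact: bool_irrelevance | congr bten; exact: bool_irrelevance].
Qed.

End Associator.
End Collections.

Section UnitCollection.
Variable K : fieldType.

(* [zstar t] is the one-point set { * } if b_t = 0 and is empty otherwise. *)
Definition zstar (t : tword) := {u : unit | allzero t}.

Definition unitc : collection K := fun t => freesp K (zstar t).

Definition star (alpha : seq side) : unitc (zword alpha) :=
  bvec K (exist _ tt (allzero_zword alpha) : zstar (zword alpha)).

(* The identifications v |-> * (x) v of V with unitc [x] V, and v |-> v (x) *
   of V with V [x] unitc, where [x] is box; see lunit_bij and runit_bij. *)
Definition lunit_fun (V : collection K) t (v : V t) : box unitc V t :=
  bten (is_comp_zwordl t) (star (target t)) v.
Definition runit_fun (V : collection K) t (v : V t) : box V unitc t :=
  bten (is_comp_zwordr t) v (star (source t)).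

Lemma lunit_linear V t : linear (@lunit_fun V t).
Proof.
move=> a x y.
by case: (bten_bilinear unitc V (is_comp_zwordl t)) => _; exact.
Qed.

Lemma runit_linear V t : linear (@runit_fun V t).
Proof.
move=> a x y.
by case: (bten_bilinear V unitc (is_comp_zwordr t)) => + _; exact.
Qed.

HB.instance Definition _ V t :=
  GRing.isLinear.Build K _ _ _ (@lunit_fun V t) (@lunit_linear V t).
HB.instance Definition _ V t :=
  GRing.isLinear.Build K _ _ _ (@runit_fun V t) (@runit_linear V t).

Definition lunit (V : collection K) : mor V (box unitc V) := fun t => @lunit_fun V t.
Definition runit (V : collection K) : mor V (box V unitc) := fun t => @runit_fun V t.

(* The value at * of an element of unitc t, 0 if there is no such point. *)
Definition at_star t (x : unitc t) : K^o := \sum_u x u.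

Lemma at_star_star alpha : at_star (star alpha) = 1.
Proof.
rewrite /at_star (bigD1 (exist _ tt (allzero_zword alpha) : zstar _)) //=.
rewrite ffunE eqxx big1 ?addr0 // => -[[] h] /eqP[]; exact: val_inj.
Qed.

Lemma at_star_linear t : linear (@at_star t).
Proof.
move=> a x y; rewrite /at_star scaler_sumr -big_split; apply: eq_bigr => u _.
by rewrite !ffunE.
Qed.

Lemma unitcE alpha (x : unitc (zword alpha)) : x = at_star x *: star alpha.
Proof.
have E (u : zstar (zword alpha)) : u = exist _ tt (allzero_zword alpha).
  by case: u => -[] h; exact: val_inj.
apply/ffunP => u; rewrite !ffunE [u]E eqxx /at_star.
rewrite (bigD1 (exist _ tt (allzero_zword alpha) : zstar _)) //= big1 ?addr0.
  by rewrite /GRing.scale /= mulr1.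
by case.
Qed.

Lemma unitc_nonzero t (x : unitc t) : ~~ allzero t -> x = 0.
Proof. by move=> h; apply/ffunP => -[[] h']; rewrite h' in h. Qed.

Section Unitors.
Variable V : collection K.

Definition lunitV_in t r s (h : is_comp r s t) (x : unitc r) (y : V s) : V t :=
  if @eqP _ s t is ReflectT e then at_star x *: ecast z (V z) e y else 0.
Definition runitV_in t r s (h : is_comp r s t) (y : V r) (x : unitc s) : V t :=
  if @eqP _ r t is ReflectT e then at_star x *: ecast z (V z) e y else 0.

Lemma lunitV_bil t r s h : bilinear_for *:%R *:%R (@lunitV_in t r s h).
Proof.
rewrite /lunitV_in; split=> [y a x x'|x a y y'] /=; case: eqP => [e|_].
- by rewrite at_star_linear scalerDl scalerA.
- by rewrite scaler0 addr0.
- by case: t / e h => _; rewrite scalerDr !scalerA mulrC.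
- by rewrite scaler0 addr0.
Qed.

Lemma runitV_bil t r s h : bilinear_for *:%R *:%R (@runitV_in t r s h).
Proof.
rewrite /runitV_in; split=> [x a y y'|y a x x'] /=; case: eqP => [e|_].
- by case: t / e h => _; rewrite scalerDr !scalerA mulrC.
- by rewrite scaler0 addr0.
- by rewrite at_star_linear scalerDl scalerA.
- by rewrite scaler0 addr0.
Qed.

Lemma lunit_bij t : bijective (lunit V t).
Proof.
exists (blift (@lunitV_in t)) => [v|].
  rewrite [LHS](blift_bten (@lunitV_bil t)) /lunitV_in; case: eqP => // e.
  by rewrite eq_axiomK at_star_star scale1r.
have bl := blift_linear (@lunitV_bil t).
apply: box_ind => [|u v eu ev|r s h x y].
- by rewrite blift0 ?linear0 //; exact: lunitV_bil.
- by have := bl 1 u v; rewrite !scale1r => ->; rewrite linearD eu ev.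
rewrite blift_bten; last exact: lunitV_bil.
have [z|/(unitc_nonzero x) ->] := boolP (allzero r); last first.
  rewrite (bil0l (bten_bilinear _ _ h)) (bil0l (@lunitV_bil t r s h)); exact: linear0.
have /andP[/eqP rs /eqP te] := h; move: x h te; rewrite (allzeroE z) rs => x h.
rewrite comp_zwordl => te; subst s; rewrite /lunitV_in; case: eqP => // e.
rewrite eq_axiomK [x in RHS]unitcE linearZ (bilZl (bten_bilinear _ _ h)).
by congr (_ *: bten _ _ _); exact: bool_irrelevance.
Qed.

Lemma runit_bij t : bijective (runit V t).
Proof.
exists (blift (@runitV_in t)) => [v|].
  rewrite [LHS](blift_bten (@runitV_bil t)) /runitV_in; case: eqP => // e.
  by rewrite eq_axiomK at_star_star scale1r.
have bl := blift_linear (@runitV_bil t).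
apply: box_ind => [|u v eu ev|r s h y x].
- by rewrite blift0 ?linear0 //; exact: runitV_bil.
- by have := bl 1 u v; rewrite !scale1r => ->; rewrite linearD eu ev.
rewrite blift_bten; last exact: runitV_bil.
have [z|/(unitc_nonzero x) ->] := boolP (allzero s); last first.
  rewrite (bil0r (bten_bilinear _ _ h)) (bil0r (@runitV_bil t r s h)); exact: linear0.
have /andP[/eqP rs /eqP te] := h; move: x h te.
rewrite (allzeroE z); rewrite (allzeroE z) target_zword in rs; rewrite -rs => x h.
rewrite comp_zwordr => te; subst r; rewrite /runitV_in; case: eqP => // e.
rewrite eq_axiomK [x in RHS]unitcE linearZ (bilZr (bten_bilinear _ _ h)).
by congr (_ *: bten _ _ _); exact: bool_irrelevance.
Qed.

End Unitors.

End UnitCollection.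

Inductive letter (SL SR : Type) := Hole of side | VarL of SL | VarR of SR.
Arguments Hole {SL SR}.
Arguments VarL {SL SR}.
Arguments VarR {SL SR}.

Section Words.
Variables SL SR : finType.
Local Notation letter := (letter SL SR).

Definition letter_code (x : letter) : side + (SL + SR) :=
  match x with Hole a => inl a | VarL x => inr (inl x) | VarR x => inr (inr x) end.
Definition letter_decode (x : side + (SL + SR)) : letter :=
  match x with inl a => Hole a | inr (inl x) => VarL x | inr (inr x) => VarR x end.
Lemma letter_codeK : cancel letter_code letter_decode.
Proof. by case. Qed.
HB.instance Definition _ := Finite.copy letter (can_type letter_codeK).

(* S^(a, b) = [set x | ltype x == (a, b)] *)
Definition ltype (x : letter) : side * bool :=
  match x with
  | Hole a => (a, false) | VarL _ => (sideL, true) | VarR _ => (sideR, true)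
  end.

Definition word (t : tword) := {w : seq letter | map ltype w == t}.
HB.instance Definition _ t := Countable.on (word t).

Lemma word_size t (w : word t) : size (val w) == size t.
Proof. by case: w => w /= /eqP <-; rewrite size_map. Qed.
Definition word_code t (w : word t) : (size t).-tuple letter := Tuple (word_size w).
Definition word_decode t (w : (size t).-tuple letter) : option (word t) :=
  insub (val w).
Lemma word_codeK t : pcancel (@word_code t) (@word_decode t).
Proof. by case=> w h; rewrite /word_decode /= insubT. Qed.
HB.instance Definition _ t : isFinite (word t) := PCanIsFinite (@word_codeK t).

Lemma hole_word_type t : allzero t -> map ltype (map Hole (source t)) == t.
Proof. by move=> /allzeroE {2}->; rewrite -map_comp. Qed.
(* The incomplete word alpha_t of type t, when b_t = 0. *)
Definition hole_word t (h : allzero t) : word t :=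
  exist _ (map Hole (source t)) (hole_word_type h).

(* w_{I ~> 0}, where close turns a letter into the placeholder of its side. *)
Definition translucid T n (I : {set 'I_n}) (close : T -> T) (w : seq T) : seq T :=
  [seq if p.1 then close p.2 else p.2 | p <- zip [seq i \in I | i <- enum 'I_n] w].

Section Translucidation.
Variables (t : tword) (I : {set 'I_(size t)}).

Definition ttransl : tword := translucid I (fun x => (x.1, false)) t.

Lemma restr_type (w : word t) : map ltype (restr I (val w)) == restr I t.
Proof. by rewrite /restr map_mask (eqP (valP w)). Qed.
Definition wrestr (w : word t) : word (restr I t) := exist _ (restr I (val w)) (restr_type w).

Lemma trans_type (w : word t) :
  map ltype (translucid I (fun x => Hole (ltype x).1) (val w)) == ttransl.
Proof.
case: w => w /= /eqP tE; rewrite /ttransl /translucid; move: [seq i \in I | i <- enum 'I_(size t)] => m.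
rewrite -tE; elim: w m {tE} => [|x w IH] [|b m] //=.
by rewrite (eqP (IH m)); case: b.
Qed.
Definition wtransl (w : word t) : word ttransl := 
  exist _ (translucid I (fun x => Hole (ltype x).1) (val w)) (trans_type w).

Let m := [seq i \in I | i <- enum 'I_(size t)].

Lemma ind_size : size m = size t.
Proof. by rewrite size_map size_enum_ord. Qed.

Lemma ind_nth x0 i (it : (i < size t)%N) : nth false m i = (Ordinal it \in I) /\
  nth x0 t i = tnth (in_tuple t) (Ordinal it).
Proof.
split; last by rewrite (tnth_nth x0).
rewrite (nth_map (Ordinal it)) ?size_enum_ord //; congr (_ \in I).
by apply: val_inj; rewrite /= nth_enum_ord.
Qed.

Lemma zeros_sub : zeros t \subset I -> all (fun p => p.2.2 || p.1) (zip m t).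
Proof.
move=> /subsetP zI; apply/(all_nthP (false, (sideL, false))) => i.
rewrite size_zip ind_size minnn => it; rewrite nth_zip ?ind_size //=.
have [-> ->] := ind_nth (sideL, false) it.
by case h: (tnth _ _).2 => //=; apply: zI; rewrite inE h.
Qed.

Lemma is_comp_restr : zeros t \subset I -> is_comp (restr I t) ttransl t.
Proof.
move=> /zeros_sub; rewrite /is_comp /restr /ttransl /translucid -/m.
move: ind_size; generalize m => m'; elim: t m' => [|[a b] s IH] [|c m'] //=.
  by rewrite target_nil eqxx.
move=> [/IH {}IH] /andP[bc /IH /andP[/eqP es /eqP ec]]; rewrite target_cons.
by case: c b bc => -[] //= _; rewrite /source /= -?/(source _) es ec !eqxx.
Qed.

Lemma restr_nonzero : zeros t \proper I -> ~~ allzero (restr I t).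
Proof.
case/properP=> _ [i iI]; rewrite inE negbK => ti.
apply/allPn; exists (tnth (in_tuple t) i); last by rewrite negbK.
rewrite /restr -/m -[X in _ \in mask _ X](map_tnth_enum (in_tuple t)) -map_mask.
by rewrite map_f // /m -filter_mask mem_filter mem_enum andbT.
Qed.

Lemma trans_nonzero :
  zeros t \subset I -> I \proper [set: 'I_(size t)] -> ~~ allzero ttransl.
Proof.
move=> /subsetP zI /properP[_ [i _ iI]].
apply/allPn; exists (tnth (in_tuple t) i); last first.
  by rewrite negbK; apply: contraNT iI => h; apply: zI; rewrite inE.
apply/(nthP (sideL, false)); exists (val i); first by rewrite size_map size_zip -/m ind_size minnn ltn_ord.
rewrite /ttransl /translucid -/m.
rewrite (nth_map (false, (sideL, false))) ?size_zip ?ind_size ?minnn ?ltn_ord //.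
rewrite nth_zip ?ind_size //=; have [-> ->] := ind_nth (sideL, false) (ltn_ord i).
by have -> : Ordinal (ltn_ord i) = i by [apply: val_inj]; rewrite (negbTE iI).
Qed.

End Translucidation.

Definition isub (t : tword) := {I : {set 'I_(size t)} | zeros t \subset I}.

Definition psub (t : tword) :=
  {I : {set 'I_(size t)} | (zeros t \proper I) && (I \proper [set: 'I_(size t)])}.

Lemma psub_sub t (I : psub t) : zeros t \subset val I.
Proof. by case: I => I /= /andP[/proper_sub]. Qed.

Lemma psub_restr t (I : psub t) : ~~ allzero (restr (val I) t).
Proof. by case: I => I /= /andP[h _]; exact: restr_nonzero. Qed.

Lemma psub_trans t (I : psub t) : ~~ allzero (ttransl (val I)).
Proof. by case: I => I /= /andP[/proper_sub zI h]; exact: trans_nonzero. Qed.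

Definition neck_le (t : tword) (i j : 'I_(size t)) : bool :=
  match (tnth (in_tuple t) i).1, (tnth (in_tuple t) j).1 with
  | sideL, sideL => i <= j
  | sideL, sideR => true
  | sideR, sideL => false
  | sideR, sideR => j <= i
  end%N.

(* None if and only if A is empty, see neck_minP. *)
Definition neck_min (t : tword) (A : {set 'I_(size t)}) : option 'I_(size t) :=
  [pick i in A | [forall j in A, neck_le i j]].

Lemma neck_le_total t : total (@neck_le t).
Proof.
by move=> i j; rewrite /neck_le; case: (tnth _ i).1 (tnth _ j).1 => -[] //; exact: leq_total.
Qed.

Lemma neck_le_trans t : transitive (@neck_le t).
Proof.
move=> j i k; rewrite /neck_le.
case: (tnth _ i).1 (tnth _ j).1 (tnth _ k).1 => -[] [] //; first exact: leq_trans.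
by move=> h1 h2; exact: leq_trans h2 h1.
Qed.

Lemma neck_le_anti t : antisymmetric (@neck_le t).
Proof.
move=> i j; rewrite /neck_le => h; apply: val_inj; apply/eqP; move: h.
by case: (tnth _ i).1 (tnth _ j).1 => -[] //; rewrite eqn_leq // andbC.
Qed.

Lemma neck_minP (t : tword) (A : {set 'I_(size t)}) : A != set0 ->
  exists2 i, neck_min A = Some i & i \in A /\ forall j, j \in A -> neck_le i j.
Proof.
move=> /set0Pn[i0 i0A]; rewrite /neck_min; case: pickP => [i /andP[iA /forall_inP h]|h].
  by exists i.
exfalso; pose s := sort (@neck_le t) (enum A).
have sA j : (j \in s) = (j \in A) by rewrite mem_sort mem_enum.
case E: s sA (sort_sorted (@neck_le_total t) (enum A)) => [|i s'] sA.
  by have := sA i0; rewrite i0A.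
rewrite -/s E /= (path_sortedE (@neck_le_trans t)) => /andP[/allP le_i _].
have /negP[] := negbT (h i); rewrite -sA mem_head; apply/forall_inP => j.
rewrite -sA inE => /predU1P[->|/le_i //].
by have := neck_le_total i i; rewrite orbb.
Qed.

(* W^+(t) *)
Definition wordp (t : tword) := {w : word t | ~~ allzero t}.

Definition wprestr t (I : psub t) (w : wordp t) : wordp (restr (val I) t) :=
  exist _ (wrestr (val I) (val w)) (psub_restr I).
Definition wptransl t (I : psub t) (w : wordp t) : wordp (ttransl (val I)) :=
  exist _ (wtransl (val I) (val w)) (psub_trans I).

Variable K : fieldType.

Definition CW : collection K := fun t => freesp K (word t).
Definition CWp : collection K := fun t => freesp K (wordp t).

Definition incl : mor CWp CW := fun t => lext (fun w : wordp t => bvec K (val w)).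

Definition Delta : mor CW (box CW CW) := fun t =>
  lext (fun w : word t => \sum_(I : isub t)
    bten (V1 := CW) (V2 := CW) (is_comp_restr (valP I))
      (bvec K (wrestr (val I) w)) (bvec K (wtransl (val I) w))).

Definition Dhalf (P : forall t : tword, pred {set 'I_(size t)}) : mor CWp (box CWp CWp) :=
  fun t => lext (fun w : wordp t => \sum_(I : psub t | P t (val I))
    bten (V1 := CWp) (V2 := CWp) (is_comp_restr (psub_sub I))
      (bvec K (wprestr I w)) (bvec K (wptransl I w))).

Definition neck_in (t : tword) (I : {set 'I_(size t)}) : bool :=
  if neck_min (ones t) is Some i then i \in I else false.

Definition Dprec : mor CWp (box CWp CWp) := Dhalf (fun t I => neck_in I).
Definition Dsucc : mor CWp (box CWp CWp) := Dhalf (fun t I => ~~ neck_in I).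
Definition Dbar : mor CWp (box CWp CWp) := mor_add Dprec Dsucc.

Definition eps : mor CW (unitc K) := fun t =>
  lext (fun w : word t => if insub tt is Some u then bvec K (u : zstar t) else 0).

Definition eta : mor (unitc K) CW := fun t =>
  lext (fun u : zstar t => bvec K (hole_word (valP u))).

Lemma eps_hole alpha :
  eps (zword alpha) (bvec K (hole_word (allzero_zword alpha))) = star K alpha.
Proof. by rewrite /eps /= lext_bvec insubT ?allzero_zword // => h; congr bvec; exact: val_inj. Qed.

Lemma eps_nonzero t : ~~ allzero t -> eps t =1 \0.
Proof.
move=> h v; rewrite /eps /= /lext big1 // => w _; rewrite insubF ?scaler0 //.
exact: negbTE.
Qed.

Lemma eta_star alpha :
  eta (zword alpha) (star K alpha) = bvec K (hole_word (allzero_zword alpha)).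
Proof. by rewrite /eta /= /star lext_bvec; congr bvec; exact: val_inj. Qed.

(* n.+1 factors, associated to the right *)
Fixpoint rpow (V : collection K) (n : nat) : collection K :=
  if n is n'.+1 then box V (rpow V n') else V.

(* Dbar_pow n is the iterate of exponent n.+1: exponents start from 1. With
   associators suppressed, Dbar (x) id applies Dbar to the first factor. *)
Fixpoint Dbar_pow (n : nat) : mor CWp (rpow CWp n.+1) :=
  match n with
  | 0 => Dbar
  | n'.+1 => mor_comp (assoc CWp CWp (rpow CWp n'))
               (mor_comp (bmap Dbar (mor_id (rpow CWp n'))) (Dbar_pow n'))
  end.

End Words.

(* Main.v *)
Require Import Defs.
From mathcomp Require Import all_boot all_order all_algebra.
From mathcomp Require Import finmap reals complex.

Set Implicit Arguments.
Unset Strict Implicit.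
Unset Printing Implicit Defensive.

Import GRing.Theory.
Local Open Scope ring_scope.

(** Everything follows from describing a subset [I] of the positions of a word
    by a bit mask, so that [w|_I] is [mask m w] and the translucidation of [w]
    at [I] is [close_at lclose m w].

    Both iterations in an unshuffle relation, [(D1 [x] id) o D2] and
    [(id [x] D3) o D4], are sums over the chains [I1 \subset I2] of sets of positions
    that contain the holes.  Cutting first at [I2] and then at [I1] inside
    [w|_I2], or first at [I1] and then at [I2] inside [w] closed at [I1],
    produces the same three words.  Only the side conditions differ.  They ask
    whether the least variable for the necklace order lies in [I1] or [I2],
    where least means least in [w|_I2] in the first case and least outside
    [I1] in the second.  If the least variable of [w] is in [I2] it is still the
    least one of [w|_I2]; if it is not in [I1] it is still the least one after
    closing [w] at [I1].  Hence both conditions become the same condition on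
    the chain: the least variable is in [I1] for the first relation, not in
    [I2] for the second, in [I2] but not in [I1] for the third.  See
    [sum_chains], [neck_bit_mask], [neck_bit_close] and [cuts_coassoc].

    To avoid transporting vectors along equalities of translucent words, a word
    is represented by a family of vectors indexed by all translucent words, zero
    except at the type of the word ([text_vec]); [bfam] is the tensor product of
    such families, and it is compatible with [bmap] and [assoc].  A word without
    variable has no basis vector in [CWp], hence the zero family, so that the
    strictness conditions on [I] in the half-unshuffle coproducts can be dropped.

    The counit relations and the expression of the coproduct through the reduced
    one isolate the terms where [I] is the set of holes or the set of all
    positions.  For nilpotency, the number of variables is additive under
    composition of translucent words and a factor without variable is zero, so
    that the whole iterated power [rpow CWp n] vanishes at a type with at most [n]
    variables ([rpow_eq0]). *)

(** * Tensor products of families of vectors *)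

Section Families.
Variable K : fieldType.
Implicit Types V : collection K.

(** The tensor product of two families of vectors: at [t] it is the sum of
    [a r (x) b s] over all factorisations [t = r o s]. *)
Definition bfam V1 V2 (a : forall t, V1 t) (b : forall t, V2 t) t : box V1 V2 t :=
  [ffun p : factn t => ten (a (val p).1) (b (val p).2)].

(** The family vanishes away from the type [r]. *)
Definition concentrated V (a : forall t, V t) r := forall t, t != r -> a t = 0.

Lemma ten0l (V W : lmodType K) (y : W) : ten (0 : V) y = 0.
Proof. exact: (bil0l (@ten_bilinear K V W)). Qed.

Lemma ten0r (V W : lmodType K) (x : V) : ten x (0 : W) = 0.
Proof. exact: (bil0r (@ten_bilinear K V W)). Qed.

Lemma bten0l V1 V2 r s t (h : is_comp r s t) (y : V2 s) :
  bten h (0 : V1 r) y = 0.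
Proof. exact: (bil0l (bten_bilinear V1 V2 h)). Qed.

Lemma bten0r V1 V2 r s t (h : is_comp r s t) (x : V1 r) :
  bten h x (0 : V2 s) = 0.
Proof. exact: (bil0r (bten_bilinear V1 V2 h)). Qed.

Section Bfam.
Variables (V1 V2 : collection K).
Implicit Types (a : forall t, V1 t) (b : forall t, V2 t).

Lemma bfamE a b t :
  bfam a b t = \sum_(p : factn t) bten (proj2_sig p) (a (val p).1) (b (val p).2).
Proof.
rewrite [LHS]dsum_decomp; apply: eq_bigr => -[[r s] h] _.
by rewrite ffunE.
Qed.

Lemma eq_bfam a a' b b' t : (forall t, a t = a' t) -> (forall t, b t = b' t) ->
  bfam a b t = bfam a' b' t.
Proof. by move=> ea eb; apply/ffunP => p; rewrite !ffunE ea eb. Qed.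

Lemma bfam0l b t : bfam (fun t => 0 : V1 t) b t = 0.
Proof. by apply/ffunP => p; rewrite !ffunE ten0l. Qed.

Lemma bfam0r a t : bfam a (fun t => 0 : V2 t) t = 0.
Proof. by apply/ffunP => p; rewrite !ffunE ten0r. Qed.

Lemma bfam_suml I (r : seq I) (P : pred I) (F : I -> forall t, V1 t) b t :
  bfam (fun t => \sum_(i <- r | P i) F i t) b t = \sum_(i <- r | P i) bfam (F i) b t.
Proof.
apply/ffunP => p; rewrite dsum_sumE ffunE.
rewrite (big_morph (fun x => ten x (b (val p).2)) (id1 := 0) (op1 := +%R)).
- by apply: eq_bigr => i _; rewrite ffunE.
- by move=> x y; exact: tenDl.
- exact: ten0l.
Qed.

Lemma bfam_sumr I (r : seq I) (P : pred I) a (F : I -> forall t, V2 t) t :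
  bfam a (fun t => \sum_(i <- r | P i) F i t) t = \sum_(i <- r | P i) bfam a (F i) t.
Proof.
apply/ffunP => p; rewrite dsum_sumE ffunE.
rewrite (big_morph (fun x => ten (a (val p).1) x) (id1 := 0) (op1 := +%R)).
- by apply: eq_bigr => i _; rewrite ffunE.
- by move=> x y; exact: tenDr.
- exact: ten0r.
Qed.

Lemma bfam_bten a b r s t (h : is_comp r s t) :
  concentrated a r -> concentrated b s -> bfam a b t = bten h (a r) (b s).
Proof.
move=> ca cb; rewrite bfamE (bigD1 (exist _ (r, s) h : factn t)) //=.
rewrite big1 ?addr0 // => -[[r' s'] h'] /eqP ne /=.
have [er|/ca->] := eqVneq r' r; last exact: bten0l.
have [es|/cb->] := eqVneq s' s; last exact: bten0r.
by case: ne; apply: val_inj; rewrite /= er es.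
Qed.

Lemma bfam_eq0 a b r s t :
  concentrated a r -> concentrated b s -> ~~ is_comp r s t -> bfam a b t = 0.
Proof.
move=> ca cb nrs; rewrite bfamE big1 // => -[[r' s'] h] _ /=.
have [er|/ca->] := eqVneq r' r; last exact: bten0l.
have [es|/cb->] := eqVneq s' s; last exact: bten0r.
by case/negP: nrs; rewrite -er -es.
Qed.

Lemma bfam_concentrated a b r s :
  concentrated a r -> concentrated b s -> concentrated (bfam a b) (tcomp r s).
Proof.
move=> ca cb t nt; apply: (bfam_eq0 ca cb).
by rewrite /is_comp [tcomp r s == t]eq_sym (negbTE nt) andbF.
Qed.

End Bfam.

Lemma bmap_bfam V1 V2 V1' V2' (f : mor V1 V1') (g : mor V2 V2')
    (a : forall t, V1 t) (b : forall t, V2 t) t :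
  bmap f g t (bfam a b t) = bfam (fun t => f t (a t)) (fun t => g t (b t)) t.
Proof.
by rewrite !bfamE linear_sum; apply: eq_bigr => p _; rewrite bmap_bten.
Qed.

(** If [p], [q], [s] do not compose, or if their composition is not [t],
    both sides vanish; otherwise this is the definition of [assoc]. *)
Lemma assoc_bfam V1 V2 V3 (a : forall t, V1 t) (b : forall t, V2 t)
    (c : forall t, V3 t) p q s t :
  concentrated a p -> concentrated b q -> concentrated c s ->
  assoc V1 V2 V3 t (bfam (bfam a b) c t) = bfam a (bfam b c) t.
Proof.
move=> ca cb cc.
have cab := bfam_concentrated ca cb; have cbc := bfam_concentrated cb cc.
have [/eqP epq|npq] := boolP (source p == target q); last first.
  have -> : bfam (bfam a b) c t = 0.
    rewrite -(@bfam0l (box V1 V2) _ c t); apply: eq_bfam => // r.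
    by apply: (bfam_eq0 ca cb); rewrite /is_comp (negbTE npq).
  rewrite linear0; symmetry.
  have [/eqP eqs|nqs] := boolP (source q == target s).
    apply: (bfam_eq0 ca cbc).
    by rewrite /is_comp target_comp // (negbTE npq).
  rewrite -(@bfam0r _ (box V2 V3) a t); apply: eq_bfam => // r.
  by apply: (bfam_eq0 cb cc); rewrite /is_comp (negbTE nqs).
have hpq : is_comp p q (tcomp p q) by rewrite /is_comp epq !eqxx.
have [h|nh] := boolP (is_comp (tcomp p q) s t); last first.
  rewrite (bfam_eq0 cab cc nh) linear0; symmetry.
  have [/eqP eqs|nqs] := boolP (source q == target s).
    apply: (bfam_eq0 ca cbc); apply: contra nh.
    by rewrite /is_comp source_comp // eqs eqxx Defs.compA // => /andP[].
  rewrite -(@bfam0r _ (box V2 V3) a t); apply: eq_bfam => // r.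
  by apply: (bfam_eq0 cb cc); rewrite /is_comp (negbTE nqs).
rewrite (bfam_bten h cab cc) (bfam_bten hpq ca cb) assoc_bten.
by rewrite (bfam_bten (is_comp_a h hpq) ca cbc) (bfam_bten (is_comp_r h hpq) cb cc).
Qed.

End Families.

(** * Families attached to words *)

(** The collections of words and of words with at least one variable are treated
    together: [X t] is a finite set of words of type [t] and [txt] sends such a
    word to its sequence of letters. *)
Section Texts.
Variables (SL SR : finType) (K : fieldType).
Local Notation letter := (letter SL SR).
Variables (X : tword -> finType) (txt : forall t, X t -> seq letter).
Hypothesis txt_type : forall t (x : X t), map (@ltype SL SR) (txt x) = t.
Hypothesis txt_inj : forall t, injective (@txt t).

(** The family of the basis vectors attached to the sequence of letters [u]; at
    [t] it is zero if [u] does not represent an element of [X t]. *)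
Definition text_vec (u : seq letter) t : freesp K (X t) :=
  [ffun x => (txt x == u)%:R].

Lemma text_vecE t (x : X t) : text_vec (txt x) t = bvec K x.
Proof. by apply/ffunP => y; rewrite !ffunE (inj_eq (@txt_inj t)). Qed.

Lemma text_vec_concentrated u :
  concentrated (V := fun t => freesp K (X t)) (text_vec u) (map (@ltype SL SR) u).
Proof.
move=> t ne; apply/ffunP => x; rewrite !ffunE; case: eqP => // e.
by rewrite -e txt_type eqxx in ne.
Qed.

End Texts.

(** The right-hand side depends on the words only through their letters, which
    makes it possible to replace [r] and [s] by equal types. *)
Lemma bten_text_vec (SL SR : finType) (K : fieldType)
    (X : tword -> finType) (txt : forall t, X t -> seq (letter SL SR))
    (txt_type : forall t (x : X t), map (@ltype SL SR) (txt t x) = t)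
    (txt_inj : forall t, injective (txt t))
    (V1 V2 : collection K)
    (f : mor (fun t => freesp K (X t)) V1) (g : mor (fun t => freesp K (X t)) V2)
    r s t (h : is_comp r s t) (x : X r) (y : X s) :
  bten h (f r (bvec K x)) (g s (bvec K y)) =
  bfam (fun t => f t (text_vec K txt (txt r x) t))
       (fun t => g t (text_vec K txt (txt s y) t)) t.
Proof.
rewrite (bfam_bten h) ?(text_vecE K txt_inj) // => z nz.
  by rewrite (text_vec_concentrated K txt_type) ?linear0 // txt_type.
by rewrite (text_vec_concentrated K txt_type) ?linear0 // txt_type.
Qed.

Lemma mor_ext (K : fieldType) (X : tword -> finType) (V : collection K)
    (f g : mor (fun t => freesp K (X t)) V) :
  (forall t (x : X t), f t (bvec K x) = g t (bvec K x)) -> mor_eq f g.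
Proof.
move=> fg t v; rewrite [v]free_decomp !linear_sum; apply: eq_bigr => x _.
by rewrite !linearZ fg.
Qed.

(** * Masks and chains of masks *)

(** The translucidation of [w] at the positions selected by [m]: by definition,
    [translucid I close w] is [close_at close m w] for the mask [m] of [I]. *)
Definition close_at T (close : T -> T) (m : bitseq) (w : seq T) : seq T :=
  [seq if p.1 then close p.2 else p.2 | p <- zip m w].

(** Replaces a letter of a translucent word by the placeholder type of its side. *)
Definition tclose (x : side * bool) : side * bool := (x.1, false).

(** The masks of the sets of positions of [t] that contain [zeros t]. *)
Fixpoint masks (t : tword) : seq bitseq :=
  if t is (_, b) :: t' then
    map (cons true) (masks t') ++ (if b then map (cons false) (masks t') else [::])
  else [:: [::]].

(** If [j] selects positions of [mask m w], then [expand m j] selects the same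
    letters as positions of [w]. *)
Fixpoint expand (m j : bitseq) : bitseq :=
  match m with
  | true :: m' => head false j :: expand m' (behead j)
  | false :: m' => false :: expand m' j
  | [::] => [::]
  end.

Lemma mem_masks t m :
  (m \in masks t) = (size m == size t) && all2 (fun b x => x.2 || b) m t.
Proof.
have inj b : injective (cons b) by move=> x y [].
have ne b c (l : seq bitseq) n : b != c -> (b :: n \in map (cons c) l) = false.
  by move=> bc; apply/mapP => -[k _ [e _]]; rewrite e eqxx in bc.
elim: t m => [|[a b] t IH] [|c m] //.
  by apply/negbTE; rewrite /= mem_cat negb_or; case: b; rewrite ?andbT;
    try (apply/andP; split); apply/mapP => -[].
have -> : all2 (fun b x => x.2 || b) (c :: m) ((a, b) :: t) =
    (b || c) && all2 (fun b (x : side * bool) => x.2 || b) m t by [].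
rewrite [masks _]/= mem_cat eqSS; case: c.
  rewrite mem_map; last exact: inj.
  by rewrite orbT IH; case: b; rewrite ?ne ?in_nil ?orbF.
rewrite ne //= orbF; case: b => /=; last by rewrite andbF.
by rewrite mem_map ?IH //; exact: inj.
Qed.

Lemma masks_uniq t : uniq (masks t).
Proof.
elim: t => [|[a b] t IH] //=; rewrite cat_uniq map_inj_uniq ?IH; last by move=> x y [].
case: b => //=; rewrite map_inj_uniq ?IH ?andbT; last by move=> x y [].
by apply/hasPn => _ /mapP[x _ ->]; apply/mapP => -[].
Qed.

Lemma size_masks t m : m \in masks t -> size m = size t.
Proof. by rewrite mem_masks => /andP[/eqP]. Qed.

(** Two ways to enumerate the chains of two sets of positions containing the
    holes of [t]: the larger one first, then the smaller one inside the restriction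
    to it; or the smaller one first, then the larger one, which has to contain
    the holes created by closing the smaller one. *)
Lemma sum_chains (U : nmodType) t (G : bitseq -> bitseq -> U) :
  \sum_(m <- masks t) \sum_(j <- masks (mask m t)) G (expand m j) m =
  \sum_(m <- masks t) \sum_(m' <- masks (close_at tclose m t)) G m m'.
Proof.
elim: t G => [|[a b] t IH] G; first by rewrite /= !big_seq1.
rewrite [masks (_ :: _)]/= !big_cat !big_map /=.
(* When the head is a variable, a chain contains it in both sets ([E1]), in the
   larger one only, or in neither. *)
have E1 : \sum_(m <- masks t) \sum_(j <- masks (mask m t)) G (true :: expand m j) (true :: m) =
    \sum_(m <- masks t) \sum_(m' <- masks (close_at tclose m t)) G (true :: m) (true :: m').
  exact: (IH (fun x y => G (true :: x) (true :: y))).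
case: b => /=; last first.
  rewrite !big_nil !addr0.
  under eq_bigr do rewrite cats0 big_map /=.
  by under [RHS]eq_bigr do rewrite cats0 big_map /=; exact: E1.
rewrite !big_map /=.
under eq_bigr do rewrite big_cat !big_map /=.
under [X in _ = X + _]eq_bigr do rewrite cats0 big_map /=.
under [X in _ = _ + X]eq_bigr do rewrite big_cat !big_map /=.
rewrite !big_split /= E1 -addrA; congr (_ + (_ + _)).
  exact: (IH (fun x y => G (false :: x) (true :: y))).
exact: (IH (fun x y => G (false :: x) (false :: y))).
Qed.

Section Words.
Variables (T : Type) (close : T -> T).
Hypothesis closeK : forall x, close (close x) = close x.

Lemma mask_mask (m j : bitseq) (w : seq T) :
  size m = size w -> size j = size (mask m w) ->
  mask j (mask m w) = mask (expand m j) w.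
Proof.
elim: w m j => [|x w IH] [|[] m] j //=.
- by case: j.
- by case: j => [|[] j] //= [sm] [sj]; rewrite IH.
- by move=> [sm] sj; rewrite IH.
Qed.

Lemma close_mask (m j : bitseq) (w : seq T) :
  size m = size w -> size j = size (mask m w) ->
  close_at close j (mask m w) = mask m (close_at close (expand m j) w).
Proof.
elim: w m j => [|x w IH] [|[] m] j //=.
- by case: j.
- by case: j => [|[] j] //= [sm] [sj]; congr (_ :: _); exact: IH.
- by move=> [sm] sj; exact: IH.
Qed.

Lemma close_close (m m' : bitseq) (w : seq T) :
  size m = size m' -> all2 implb m m' ->
  close_at close m' (close_at close m w) = close_at close m' w.
Proof.
elim: w m m' => [|x w IH] [|b m] [|b' m'] //= [sm] /andP[bb le].
by congr (_ :: _); [case: b bb; case: b' => // _; rewrite closeK | exact: (IH m)].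
Qed.

End Words.

Lemma expand_le m j : all2 implb (expand m j) m.
Proof. elim: m j => [|[] m IH] j //=; by rewrite IH implybT. Qed.

Lemma size_expand m j : size (expand m j) = size m.
Proof. by elim: m j => [|[] m IH] j //=; rewrite IH. Qed.

Lemma masks_close_le t m m' : m \in masks t ->
  m' \in masks (close_at tclose m t) -> size m' = size t /\ all2 implb m m'.
Proof.
move=> /size_masks sm; rewrite mem_masks /close_at size_map size_zip sm minnn.
move=> /andP[/eqP sm' le]; split=> //.
elim: t m m' sm sm' le => [|[a b] t IH] [|c m] [|c' m'] //= [sm] [sm'].
case/andP=> cc le; rewrite (IH m m') // andbT.
by case: c cc.
Qed.

Lemma comp_mask t m : m \in masks t -> is_comp (mask m t) (close_at tclose m t) t.
Proof.
rewrite mem_masks /is_comp => /andP[/eqP sm le].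
elim: t m sm le => [|[a b] t IH] [|c m] //=; first by rewrite target_nil eqxx.
move=> [sm] /andP[bc /(IH _ sm) /andP[/eqP es /eqP ec]].
by rewrite target_cons; case: c bc; case: b => //= _; rewrite /source /= -?/(source _) es ec !eqxx.
Qed.

(** * The least variable for the necklace order *)

(** The bit of [m] at the position of the least variable of [t] for the necklace
    order, [None] if there is none.  A left variable at the head is the least
    one, whereas a right variable at the head is the greatest one. *)
Fixpoint neck_bit (t : tword) (m : bitseq) : option bool :=
  match t, m with
  | (a, b) :: t', c :: m' =>
      if ~~ b then neck_bit t' m'
      else if a is sideL then Some c
      else if neck_bit t' m' is Some d then Some d else Some c
  | _, _ => None
  end.

Lemma neck_bit_isSome t m : size m = size t -> neck_bit t m = ~~ allzero t :> bool.
Proof.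
elim: t m => [|[a b] t IH] [|c m] //= [sm]; have := IH m sm.
by case: b; case: a => //=; case: (neck_bit t m).
Qed.

Lemma neck_bit_le t m m' : size m = size t -> size m' = size t -> all2 implb m m' ->
  neck_bit t m = Some true -> neck_bit t m' = Some true.
Proof.
elim: t m m' => [|[a b] t IH] [|c m] [|c' m'] //= [sm] [sm'] /andP[cc le].
case: b => /=; last exact: IH.
case: a; first by case: c cc; case: c'.
have := neck_bit_isSome sm; have := neck_bit_isSome sm'.
case E: (neck_bit t m) => [d|]; case E': (neck_bit t m') => [d'|] //=; try by move=> <-.
  by move=> _ _ [dE]; move: E; rewrite dE => /(IH _ _ sm sm' le); rewrite E'.
by case: c cc; case: c'.
Qed.

(** The least variable of [t] is the least one of [mask m t] when [m] selects it. *)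
Lemma neck_bit_mask t m j : size m = size t -> size j = size (mask m t) ->
  neck_bit t m = Some true -> neck_bit (mask m t) j = neck_bit t (expand m j).
Proof.
elim: t m j => [|[a b] t IH] [|c m] j //= [sm].
case: c j => [[|d j]|j] //=; last first.
  move=> sj; case: b => /=; last by move/(IH m j sm sj).
  case: a => //; have := neck_bit_isSome sm; case E: (neck_bit t m) => [d|] // se [dE].
  have := IH m j sm sj; rewrite E dE => -> //.
  have := @neck_bit_isSome t (expand m j); rewrite size_expand -se sm => /(_ erefl).
  by case: (neck_bit t _).
move=> [sj]; case: b => /=; last by move/(IH m j sm sj).
case: a => //; have := neck_bit_isSome sm; case E: (neck_bit t m) => [e|] se.
  by move=> [eE]; rewrite IH // E eE.
move=> _.
have z : allzero t by move: se => /= /esym/negbFE.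
have zm : allzero (mask m t).
  by apply/allP => x /mem_mask; move/allP: z; exact.
have := neck_bit_isSome sj; rewrite zm /=; case: (neck_bit (mask m t) j) => // _.
have := @neck_bit_isSome t (expand m j); rewrite size_expand z sm => /(_ erefl).
by case: (neck_bit t _).
Qed.

(** The least variable of [t] stays the least one after closing the positions of
    [m], when [m] does not select it. *)
Lemma neck_bit_close t m m' : size m = size t -> size m' = size t ->
  neck_bit t m != Some true -> neck_bit (close_at tclose m t) m' = neck_bit t m'.
Proof.
have zc t1 m1 : allzero t1 -> allzero (close_at tclose m1 t1).
  by elim: t1 m1 => [|x t1 IH] [|[] m1] //= /andP[xz /IH ->] //; rewrite xz.
elim: t m m' => [|[a b] t IH] [|c m] [|c' m'] //= [sm] [sm'].
rewrite -/(close_at _ _ _).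
case: b => /=; last by move=> h; rewrite -(IH m) //; case: c.
case: a; first by case: c.
have := neck_bit_isSome sm; case E: (neck_bit t m) => [d|] /= se.
  move=> h; have := IH m m' sm sm'; rewrite E => /(_ h) ->.
  have := neck_bit_isSome sm'; rewrite -se; case: (neck_bit t m') => // e _.
  by case: c.
by case: c => // _ /=; rewrite (IH m) // E.
Qed.

(** The necklace order [neck_le] on positions that are natural numbers. *)
Definition neck_le_nat (t : tword) (i j : nat) : bool :=
  match (nth (sideL, false) t i).1, (nth (sideL, false) t j).1 with
  | sideL, sideL => i <= j
  | sideL, sideR => true
  | sideR, sideL => false
  | sideR, sideR => j <= i
  end%N.

(** The position of the least variable, and the bit that [neck_bit] reads there. *)
Lemma neck_bit_spec t : ~~ allzero t -> exists2 i, (i < size t)%N &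
  [/\ (nth (sideL, false) t i).2,
      forall j, (j < size t)%N -> (nth (sideL, false) t j).2 -> neck_le_nat t i j
    & forall m, size m = size t -> neck_bit t m = Some (nth false m i)].
Proof.
elim: t => [|[a b] t IH] //=.
have [z|nz] := boolP (allzero t); last first.
  case: (IH nz) => i it [hi hmin hn].
  (* If the head is not a variable or is a right one, the least variable of the
     tail is still the least one. *)
  have shift : (b = false) \/ (a = sideR) -> exists2 i, (i < size ((a, b) :: t))%N &
    [/\ (nth (sideL, false) ((a, b) :: t) i).2,
      forall j, (j < size ((a, b) :: t))%N -> (nth (sideL, false) ((a, b) :: t) j).2 ->
        neck_le_nat ((a, b) :: t) i j
    & forall m, size m = size ((a, b) :: t) -> neck_bit ((a, b) :: t) m = Some (nth false m i)].
    move=> hab; exists i.+1 => //; split=> // [[|j] jt|[|c m] //= [sm]].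
    - rewrite /= => hb; case: hab => [bF|->]; first by rewrite bF in hb.
      by rewrite /neck_le_nat /=; case: (nth _ t i).1.
    - exact: hmin.
    - by rewrite hn //; case: hab => ->; case: b.
  move=> _; case: b shift; last by apply; left.
  case: a; last by apply; right.
  move=> _; exists 0%N => //; split=> // [j jt _|[|c m] //=].
  by rewrite /neck_le_nat /=; case: (nth _ _ j).1.
rewrite /allzero /= in z *; rewrite andbT negbK; case: b => // _.
exists 0%N => //; split=> //.
  case=> [_ _|j jt /= hj]; first by rewrite /neck_le_nat /=; case: a.
  by move/(all_nthP (sideL, false)): z => /(_ j jt); rewrite hj.
move=> [|c m] //= [sm]; case: a => //.
by have := neck_bit_isSome sm; rewrite /allzero z; case: (neck_bit t m).
Qed.

(** * Sets of positions as masks *)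

Section IndexSets.
Variable t : tword.
Local Notation maskof I := [seq i \in I | i <- enum 'I_(size t)].

Lemma maskof_masks (I : {set 'I_(size t)}) :
  (maskof I \in masks t) = (zeros t \subset I).
Proof.
rewrite mem_masks ind_size eqxx all2E ind_size eqxx /=.
apply/idP/idP => [h|/zeros_sub //].
apply/subsetP => i; rewrite inE => zi.
move/(all_nthP (false, (sideL, false))): h => /(_ i).
rewrite size_zip ind_size minnn ltn_ord => /(_ isT).
rewrite nth_zip ?ind_size //=.
have [-> ->] := ind_nth I (sideL, false) (ltn_ord i).
have -> : Ordinal (ltn_ord i) = i by apply: val_inj.
by rewrite (negbTE zi).
Qed.

Lemma maskof_set m : size m = size t ->
  maskof [set i : 'I_(size t) | nth false m i] = m.
Proof.
move=> sm; apply: (@eq_from_nth _ false); rewrite ind_size // => i it.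
by have [-> _] := ind_nth [set i : 'I_(size t) | nth false m i] (sideL, false) it; rewrite inE.
Qed.

Lemma maskof_inj : injective (fun I : {set 'I_(size t)} => maskof I).
Proof.
move=> I J /= e; apply/setP => i.
have oi : Ordinal (ltn_ord i) = i by apply: val_inj.
have [hI _] := ind_nth I (sideL, false) (ltn_ord i).
have [hJ _] := ind_nth J (sideL, false) (ltn_ord i).
by rewrite oi in hI hJ; rewrite -hI -hJ e.
Qed.

Lemma sum_sets (U : nmodType) (F : bitseq -> U) :
  \sum_(I : {set 'I_(size t)} | zeros t \subset I) F (maskof I) =
  \sum_(m <- masks t) F m.
Proof.
rewrite -big_enum /= -(big_map (fun I : {set 'I_(size t)} => maskof I) predT F).
apply: perm_big; apply: uniq_perm; last move=> m.
- by rewrite map_inj_uniq ?enum_uniq //; exact: maskof_inj.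
- exact: masks_uniq.
apply/mapP/idP => [[I + ->]|mt]; first by rewrite mem_enum maskof_masks.
have sm := size_masks mt.
exists [set i : 'I_(size t) | nth false m i]; rewrite ?maskof_set //.
by rewrite mem_enum -[_ \in _]/(zeros t \subset _) -maskof_masks maskof_set.
Qed.

End IndexSets.

Lemma neck_inE t (I : {set 'I_(size t)}) :
  neck_in I = (neck_bit t [seq i \in I | i <- enum 'I_(size t)] == Some true).
Proof.
rewrite /neck_in.
have [z|nz] := boolP (allzero t).
  have := @neck_bit_isSome t [seq i \in I | i <- enum 'I_(size t)].
  rewrite ind_size z => /(_ erefl); case: (neck_bit _ _) => // _.
  rewrite /neck_min; case: pickP => // i /andP[].
  by rewrite inE (negbTE (allP z _ (mem_tnth i (in_tuple t)))).
case: (neck_bit_spec nz) => i it [hi hmin ->]; last exact: ind_size.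
pose x0 := (sideL, false).
have [-> ei] := ind_nth I x0 it.
have io : Ordinal it \in ones t by rewrite inE -ei.
have nz1 : ones t != set0 by apply/set0Pn; exists (Ordinal it).
case: (neck_minP nz1) => k -> [ko kmin].
suff -> : k = Ordinal it by case: (_ \in I).
apply: (@neck_le_anti t); rewrite kmin //=.
have := hmin k (ltn_ord k); rewrite /neck_le_nat /neck_le -ei.
have [_ ->] := ind_nth I x0 (ltn_ord k).
have -> : Ordinal (ltn_ord k) = k by apply: val_inj.
by move: ko; rewrite inE => -> /(_ isT).
Qed.

(** * The half-unshuffle coproducts and the unshuffle relations *)

Section HalfCoproducts.
Variables (SL SR : finType) (K : fieldType).
Local Notation letter := (letter SL SR).
Local Notation CWp := (CWp SL SR K).
Local Notation types := (map (@ltype SL SR)).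

(** Replaces a letter by the placeholder of its side. *)
Definition lclose (x : letter) : letter := Hole (ltype x).1.

Lemma lclose_type m (u : seq letter) :
  types (close_at lclose m u) = close_at tclose m (types u).
Proof.
rewrite /close_at; elim: u m => [|x u IH] [|b m] //=; rewrite IH.
by case: b.
Qed.

(** The letters of a word with at least one variable. *)
Definition wptext t (w : wordp SL SR t) : seq letter := val (val w).

Lemma wptext_type t (w : wordp SL SR t) : types (wptext w) = t.
Proof. exact: (eqP (valP (val w))). Qed.

Lemma wptext_inj t : injective (@wptext t).
Proof. by move=> x y /val_inj/val_inj. Qed.

(** The family of basis vectors of a word, zero if the word has no variable. *)
Definition word_vec u : forall t, CWp t := text_vec K wptext u.

Lemma word_vec_concentrated u : concentrated (word_vec u) (types u).
Proof. exact: (text_vec_concentrated K wptext_type). Qed.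

Lemma word_vec_allzero u t : allzero (types u) -> word_vec u t = 0.
Proof.
move=> zu; apply/ffunP => x; rewrite !ffunE; case: eqP => // e.
by case: (x) => w nz; rewrite -e wptext_type in zu; rewrite zu in nz.
Qed.

(** The sum runs over all sets of positions containing the holes: for the set of
    holes and for the set of all positions one of the two factors is zero. *)
Lemma Dhalf_word_vec (P : forall t : tword, pred {set 'I_(size t)})
    (Q : tword -> pred bitseq) (u : seq letter) (t : tword) :
  (forall t I, P t I = Q t [seq i \in I | i <- enum 'I_(size t)]) ->
  Dhalf SL SR K P t (word_vec u t) =
  \sum_(m <- masks (types u) | Q (types u) m)
    bfam (word_vec (mask m u)) (word_vec (close_at lclose m u)) t.
Proof.
move=> PQ; have [et|nt] := eqVneq t (types u); last first.
  rewrite word_vec_concentrated // linear0 big_seq_cond big1 // => m /andP[/comp_mask h _].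
  apply: (bfam_eq0 (@word_vec_concentrated _) (@word_vec_concentrated _)).
  have /andP[_ /eqP e] := h.
  by rewrite map_mask lclose_type /is_comp e negb_and [_ u == t]eq_sym nt orbT.
subst t; have [z|nz] := boolP (allzero (types u)).
  rewrite word_vec_allzero // linear0 big1 // => m _.
  rewrite -(@bfam0l K CWp CWp (word_vec (close_at lclose m u))); apply: eq_bfam => // t.
  rewrite word_vec_allzero // map_mask.
  by apply/allP => x /mem_mask; move/allP: z; exact.
pose w : wordp SL SR (types u) := exist _ (exist _ u (eqxx _)) nz.
rewrite -[u in word_vec u]/(wptext w) /word_vec (text_vecE K wptext_inj) -/word_vec [LHS]lext_bvec.
set t := types u.
pose F (I : {set 'I_(size t)}) :=
  bfam (word_vec (restr I u)) (word_vec (translucid I lclose u)) t.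
transitivity (\sum_(I : psub t | P t (val I)) F (val I)).
  apply: eq_bigr => I _.
  exact: (bten_text_vec wptext_type wptext_inj (mor_id CWp) (mor_id CWp)).
rewrite -(big_sub_cond [pred I : {set 'I_(size t)} |
  (zeros t \proper I) && (I \proper [set: 'I_(size t)])] (P t) F).
rewrite big_mkcond [RHS]big_mkcond -(@sum_sets t _ (fun m => if Q t m then
  bfam (word_vec (mask m u)) (word_vec (close_at lclose m u)) t else 0)).
rewrite [RHS]big_mkcond; apply: eq_bigr => I _; rewrite inE -PQ.
have [zI|nzI] := boolP (zeros t \subset I); last first.
  by case: ifP => // /andP[/andP[/proper_sub]]; rewrite (negbTE nzI).
rewrite /F; case: (P t I); rewrite ?andbF ?andbT //.
case: ifP => // /negbT; rewrite negb_and !properE zI subsetT !negbK /=.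
(* Here [I] is the set of holes or the set of all positions. *)
case/orP => sI; symmetry.
  rewrite -(@bfam0l K CWp CWp (word_vec (translucid I lclose u)) t); apply: eq_bfam => // r.
  rewrite word_vec_allzero // map_mask.
  have -> : I = zeros t by apply/eqP; rewrite eqEsubset sI.
  rewrite -[mask _ _]/(restr (zeros t) t) (@restr_mask _ t (fun x => ~~ x.2)) -filter_mask.
  exact: filter_all.
rewrite -(@bfam0r K CWp CWp (word_vec (restr I u)) t); apply: eq_bfam => // r.
rewrite word_vec_allzero // [X in allzero X](lclose_type [seq i \in I | i <- enum 'I_(size t)]) -/t.
apply/allP => _ /mapP[[b x]] + ->.
case: b => //=; case/(nthP (false, (sideL, false))) => i.
rewrite size_zip ind_size minnn => it; rewrite nth_zip ?ind_size //=.
have [-> _] := ind_nth I (sideL, false) it.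
by move/subsetP: sI => ->; rewrite ?inE.
Qed.

End HalfCoproducts.

Section Comonoid.
Variables (SL SR : finType) (K : fieldType).
Local Notation CWp := (CWp SL SR K).
Local Notation types := (map (@ltype SL SR)).
Local Notation lclose := (@lclose SL SR).
Local Notation word_vec := (@word_vec SL SR K).
Local Notation Dprec := (Dprec SL SR K).
Local Notation Dsucc := (Dsucc SL SR K).
Local Notation Dbar := (Dbar SL SR K).

Lemma mor_ext_word_vec (V : collection K) (f g : mor CWp V) :
  (forall u t, f t (word_vec u t) = g t (word_vec u t)) -> mor_eq f g.
Proof.
move=> fg; apply: mor_ext => t x.
have <- : word_vec (wptext x) t = bvec K x by apply: text_vecE; exact: wptext_inj.
exact: fg.
Qed.

(** [D] cuts a word of type [t] at the sets of positions whose mask [m] satisfies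
    [Q t m]. *)
Definition cuts (Q : tword -> pred bitseq) (D : mor CWp (box CWp CWp)) :=
  forall u t, D t (word_vec u t) =
  \sum_(m <- masks (types u) | Q (types u) m)
    bfam (word_vec (mask m u)) (word_vec (close_at lclose m u)) t.

Lemma cuts_Dprec : cuts (fun t m => neck_bit t m == Some true) Dprec.
Proof.
move=> u t; exact: (Dhalf_word_vec K (P := fun t I => neck_in I)
  (Q := fun t m => neck_bit t m == Some true) u t (fun t I => neck_inE I)).
Qed.

Lemma cuts_Dsucc : cuts (fun t m => neck_bit t m != Some true) Dsucc.
Proof.
move=> u t; apply: (Dhalf_word_vec K (P := fun t I => ~~ neck_in I)
  (Q := fun t m => neck_bit t m != Some true) u t) => {}t I.
by rewrite neck_inE.
Qed.

Lemma cuts_Dbar : cuts (fun _ _ => true) Dbar.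
Proof.
move=> u t.
rewrite -[Dbar t _]/(Dprec t (word_vec u t) + Dsucc t (word_vec u t)) cuts_Dprec cuts_Dsucc.
by rewrite [RHS](bigID (fun m => neck_bit (types u) m == Some true)).
Qed.

(** The conditions are compared on chains: [c t m m'] is a condition on a set with
    mask [m] contained in a set with mask [m'].  In the first hypothesis the larger
    set [m] is chosen first and the smaller one is [expand m j]; in the second one
    the smaller set [m] is chosen first. *)
Lemma cuts_coassoc Q1 Q2 Q3 Q4 D1 D2 D3 D4 (c : tword -> bitseq -> bitseq -> bool) :
  cuts Q1 D1 -> cuts Q2 D2 -> cuts Q3 D3 -> cuts Q4 D4 ->
  (forall t m j, size m = size t -> size j = size (mask m t) ->
     Q2 t m && Q1 (mask m t) j = c t (expand m j) m) ->
  (forall t m m', size m = size t -> size m' = size t -> all2 implb m m' ->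
     Q4 t m && Q3 (close_at tclose m t) m' = c t m m') ->
  mor_eq (mor_comp (assoc CWp CWp CWp) (mor_comp (bmap D1 (mor_id CWp)) D2))
    (mor_comp (bmap (mor_id CWp) D3) D4).
Proof.
move=> h1 h2 h3 h4 c12 c34; apply: mor_ext_word_vec => u t.
pose T := types u.
pose G m m' := if c T m m' then bfam (word_vec (mask m u))
  (bfam (word_vec (mask m' (close_at lclose m u))) (word_vec (close_at lclose m' u))) t else 0.
rewrite -[LHS]/(assoc CWp CWp CWp t (bmap D1 (mor_id CWp) t (D2 t (word_vec u t)))) h2.
rewrite -[RHS]/(bmap (mor_id CWp) D3 t (D4 t (word_vec u t))) h4.
rewrite (linear_sum (bmap D1 (mor_id CWp) t)) (linear_sum (assoc CWp CWp CWp t)).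
rewrite (linear_sum (bmap (mor_id CWp) D3 t)).
transitivity (\sum_(m <- masks T) \sum_(j <- masks (mask m T)) G (expand m j) m).
  rewrite big_mkcond [LHS]big_seq [RHS]big_seq; apply: eq_bigr => m /size_masks sm.
  have su : size m = size u by rewrite sm size_map.
  rewrite bmap_bfam.
  case: ifP => q2; last first.
    rewrite big_seq big1 // => j /size_masks sj.
    by rewrite /G -c12 // q2.
  rewrite (eq_bfam (a' := fun t => \sum_(j <- masks (types (mask m u)) | Q1 (types (mask m u)) j)
    bfam (word_vec (mask j (mask m u))) (word_vec (close_at lclose j (mask m u))) t)
    (b' := word_vec (close_at lclose m u))) //; last exact: h1.
  rewrite bfam_suml (linear_sum (assoc CWp CWp CWp t)) map_mask -/T.
  rewrite big_mkcond [LHS]big_seq [RHS]big_seq; apply: eq_bigr => j /size_masks sj.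
  have sju : size j = size (mask m u) by rewrite sj -[in RHS](size_map (@ltype SL SR)) map_mask.
  rewrite /G -c12 // q2 /=; case: ifP => // _.
  rewrite (assoc_bfam _ (@word_vec_concentrated _ _ _ _) (@word_vec_concentrated _ _ _ _)
    (@word_vec_concentrated _ _ _ _)).
  by rewrite mask_mask // close_mask.
rewrite (sum_chains T G) [RHS]big_mkcond [LHS]big_seq [RHS]big_seq; apply: eq_bigr => m mT.
have sm := size_masks mT.
have su : size m = size u by rewrite sm size_map.
case: ifP => q4; last first.
  rewrite big_seq big1 // => m' /(masks_close_le mT)[sm' le].
  by rewrite /G -c34 // q4.
rewrite bmap_bfam (eq_bfam (a' := word_vec (mask m u))
  (b' := fun t => \sum_(m' <- masks (types (close_at lclose m u)) |
      Q3 (types (close_at lclose m u)) m')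
    bfam (word_vec (mask m' (close_at lclose m u)))
      (word_vec (close_at lclose m' (close_at lclose m u))) t)) //; last exact: h3.
rewrite bfam_sumr lclose_type -/T [RHS]big_mkcond [LHS]big_seq [RHS]big_seq.
apply: eq_bigr => m' /(masks_close_le mT)[sm' le].
rewrite /G -c34 // q4 /=; case: ifP => // _.
by rewrite close_close // sm sm'.
Qed.

Lemma unshuffle_prec :
  mor_eq (mor_comp (assoc CWp CWp CWp) (mor_comp (bmap Dprec (mor_id CWp)) Dprec))
    (mor_comp (bmap (mor_id CWp) Dbar) Dprec).
Proof.
apply: (cuts_coassoc (c := fun t m m' => neck_bit t m == Some true)
  cuts_Dprec cuts_Dprec cuts_Dbar cuts_Dprec) => [t m j sm sj|t m m' sm sm' le].
  have [n2|n2] := eqVneq (neck_bit t m) (Some true); first by rewrite neck_bit_mask.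
  apply/esym/eqP => n1; case/eqP: n2.
  by apply: neck_bit_le (expand_le m j) n1; rewrite ?size_expand.
by rewrite andbT.
Qed.

Lemma unshuffle_succ :
  mor_eq (mor_comp (assoc CWp CWp CWp) (mor_comp (bmap Dbar (mor_id CWp)) Dsucc))
    (mor_comp (bmap (mor_id CWp) Dsucc) Dsucc).
Proof.
apply: (cuts_coassoc (c := fun t m m' => neck_bit t m' != Some true)
  cuts_Dbar cuts_Dsucc cuts_Dsucc cuts_Dsucc) => [t m j sm sj|t m m' sm sm' le].
  by rewrite andbT.
have [n1|n1] := eqVneq (neck_bit t m) (Some true); last by rewrite neck_bit_close.
by rewrite (neck_bit_le sm sm' le n1).
Qed.

Lemma unshuffle_mixed :
  mor_eq (mor_comp (assoc CWp CWp CWp) (mor_comp (bmap Dsucc (mor_id CWp)) Dprec))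
    (mor_comp (bmap (mor_id CWp) Dprec) Dsucc).
Proof.
apply: (cuts_coassoc
  (c := fun t m m' => (neck_bit t m != Some true) && (neck_bit t m' == Some true))
  cuts_Dsucc cuts_Dprec cuts_Dprec cuts_Dsucc) => [t m j sm sj|t m m' sm sm' le].
  rewrite andbC; have [n2|n2] := eqVneq (neck_bit t m) (Some true); last by rewrite !andbF.
  by rewrite neck_bit_mask.
by have [n1|n1] := eqVneq (neck_bit t m) (Some true); rewrite //= neck_bit_close.
Qed.

End Comonoid.

(** * Nilpotency *)

Section Nilpotency.
Variables (SL SR : finType) (K : fieldType).
Local Notation CWp := (CWp SL SR K).

Lemma count_comp r s t : is_comp r s t ->
  (count snd t = count snd r + count snd s)%N.
Proof.
case/andP => /eqP rs /eqP <-.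
elim: s r rs => [|[a []] s IH] r.
- by rewrite target_nil; case: r.
- by rewrite target_cons /= => /IH ->; rewrite addnCA.
by rewrite target_cons; case: r => [|x r] //= [_ /IH ->]; rewrite addnA.
Qed.

Lemma CWp_eq0 t (x : CWp t) : count snd t = 0%N -> x = 0.
Proof.
move=> c0; have z : allzero t by rewrite /allzero all_predC has_count c0.
by apply/ffunP => -[w nz]; case/negP: (nz).
Qed.

(** An element of [rpow CWp n t] splits the variables of [t] among [n.+1] factors,
    each of which needs one. *)
Lemma rpow_eq0 n t (x : rpow CWp n t) : (count snd t <= n)%N -> x = 0.
Proof.
elim: n t x => [|n IH] t x; first by rewrite leqn0 => /eqP/CWp_eq0.
move=> tn; apply: (box_ind (P := fun y : box CWp (rpow CWp n) t => y = 0)) => //.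
  by move=> u v -> ->; rewrite addr0.
move=> r s h y z; have := count_comp h.
have [/CWp_eq0 y0|r0] := eqVneq (count snd r) 0%N; first by rewrite (y0 y) bten0l.
move=> e; have z0 : z = 0.
  by apply: IH; rewrite -ltnS (leq_trans _ tn) // e -add1n leq_add2r lt0n.
by subst z; exact: bten0r.
Qed.

End Nilpotency.

(** * Counit, unit and reduced coproduct *)

Section Counit.
Variables (SL SR : finType) (K : fieldType).
Local Notation letter := (letter SL SR).
Local Notation CW := (CW SL SR K).
Local Notation CWp := (CWp SL SR K).
Local Notation types := (map (@ltype SL SR)).
Local Notation lclose := (@lclose SL SR).
Local Notation Delta := (Delta SL SR K).
Local Notation Dbar := (Dbar SL SR K).
Local Notation eps := (eps SL SR K).
Local Notation eta := (eta SL SR K).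
Local Notation incl := (incl SL SR K).

(** The letters of a word. *)
Definition wtext t (w : word SL SR t) : seq letter := val w.

Lemma wtext_type t (w : word SL SR t) : types (wtext w) = t.
Proof. exact: (eqP (valP w)). Qed.

Lemma wtext_inj t : injective (@wtext t).
Proof. by move=> x y /val_inj. Qed.

Lemma restr_zeros t (w : word SL SR t) :
  restr (zeros t) (wtext w) = map Hole (target t).
Proof.
rewrite (@restr_mask _ t (fun x => ~~ x.2)) targetE.
move: (wtext w) (wtext_type w) => u <-; by elim: u => [|[a|a|a] u IH] //=; rewrite IH.
Qed.

Lemma close_zeros t (w : word SL SR t) :
  translucid (zeros t) lclose (wtext w) = wtext w.
Proof.
rewrite /translucid (eq_map (g := fun i => ~~ (tnth (in_tuple t) i).2)); last first.
  by move=> i; rewrite inE.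
rewrite (mask_enum t (fun x => ~~ x.2)).
move: (wtext w) (wtext_type w) => u <-; by elim: u => [|[a|a|a] u IH] //=; rewrite IH.
Qed.

Lemma restr_setT t (w : word SL SR t) : restr [set: 'I_(size t)] (wtext w) = wtext w.
Proof.
rewrite (_ : [set: _] = [set i | predT (tnth (in_tuple t) i)]); last first.
  by apply/setP => i; rewrite !inE.
rewrite (@restr_mask _ t predT).
move: (wtext w) (wtext_type w) => u <-; by elim: u => [|x u IH] //=; rewrite IH.
Qed.

Lemma close_setT t (w : word SL SR t) :
  translucid [set: 'I_(size t)] lclose (wtext w) = map Hole (source t).
Proof.
rewrite /translucid (eq_map (g := fun i => predT (tnth (in_tuple t) i))); last first.
  by move=> i; rewrite inE.
rewrite (mask_enum t predT).
move: (wtext w) (wtext_type w) => u <-; by elim: u => [|x u IH] //=; rewrite IH.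
Qed.

Lemma bten_wtext (V1 V2 : collection K) (f : mor CW V1) (g : mor CW V2)
    r s t (h : is_comp r s t) (x : word SL SR r) (y : word SL SR s)
    r' s' (h' : is_comp r' s' t) (x' : word SL SR r') (y' : word SL SR s') :
  wtext x = wtext x' -> wtext y = wtext y' ->
  bten h (f r (bvec K x)) (g s (bvec K y)) =
  bten h' (f r' (bvec K x')) (g s' (bvec K y')).
Proof.
move=> ex ey; rewrite (bten_text_vec wtext_type wtext_inj f g h).
by rewrite (bten_text_vec wtext_type wtext_inj f g h') ex ey.
Qed.

Lemma counit_left : mor_eq (mor_comp (bmap eps (mor_id CW)) Delta) (lunit CW).
Proof.
apply: mor_ext => t w.
rewrite -[LHS]/(bmap eps (mor_id CW) t (Delta t (bvec K w))) [Delta t _]lext_bvec.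
rewrite (linear_sum (bmap eps (mor_id CW) t)).
pose I0 : isub t := exist _ (zeros t) (subxx _).
rewrite (bigD1 I0) //= big1 ?addr0 => [|I nI]; last first.
  rewrite bmap_bten eps_nonzero ?bten0l //; apply: restr_nonzero.
  rewrite properE (valP I) /=; apply: contra nI => sI.
  by apply/eqP/val_inj/eqP; rewrite eqEsubset sI (valP I).
rewrite bmap_bten -[RHS]/(bten (is_comp_zwordl t) (star K (target t)) (bvec K w)).
rewrite -(eps_hole SL SR); apply: (bten_wtext eps (mor_id CW)).
  by rewrite -[LHS]/(restr (zeros t) (wtext w)) restr_zeros /wtext /= source_zword.
exact: close_zeros.
Qed.

Lemma counit_right : mor_eq (mor_comp (bmap (mor_id CW) eps) Delta) (runit CW).
Proof.
apply: mor_ext => t w.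
rewrite -[LHS]/(bmap (mor_id CW) eps t (Delta t (bvec K w))) [Delta t _]lext_bvec.
rewrite (linear_sum (bmap (mor_id CW) eps t)).
pose I0 : isub t := exist _ [set: 'I_(size t)] (subsetT _).
rewrite (bigD1 I0) //= big1 ?addr0 => [|I nI]; last first.
  rewrite bmap_bten eps_nonzero ?bten0r //; apply: trans_nonzero (valP I) _.
  rewrite properE subsetT /=; apply: contra nI => sI.
  by apply/eqP/val_inj/eqP; rewrite eqEsubset sI subsetT.
rewrite bmap_bten -[RHS]/(bten (is_comp_zwordr t) (bvec K w) (star K (source t))).
rewrite -(eps_hole SL SR); apply: (bten_wtext (mor_id CW) eps).
  exact: restr_setT.
by rewrite -[LHS]/(translucid _ lclose (wtext w)) close_setT /wtext /= source_zword.
Qed.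

Lemma counit_unit : mor_eq (mor_comp eps eta) (mor_id (unitc K)).
Proof.
apply: mor_ext => t u.
rewrite -[LHS]/(eps t (eta t (bvec K u))) [eta t _]lext_bvec [LHS]lext_bvec.
rewrite insubT; first exact: (valP u).
by move=> h; congr bvec; apply: val_inj; case: u => -[].
Qed.

Lemma Delta_reduced t (ht : ~~ allzero t) (w : word SL SR t) :
  Delta t (bvec K w) =
    bten (is_comp_zwordr t) (bvec K w : CW t) (eta _ (star K (source t)))
    + bten (is_comp_zwordl t) (eta _ (star K (target t))) (bvec K w : CW t)
    + bmap incl incl t (Dbar t (bvec K (exist _ w ht : wordp SL SR t))).
Proof.
pose e u : forall t, CW t := text_vec K wtext u.
pose F (I : {set 'I_(size t)}) :=
  bfam (e (restr I (wtext w))) (e (translucid I lclose (wtext w))) t.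
have bF r s (h : is_comp r s t) (x : word SL SR r) (y : word SL SR s) :
    bten h (bvec K x : CW r) (bvec K y : CW s) = bfam (e (wtext x)) (e (wtext y)) t.
  exact: (bten_text_vec wtext_type wtext_inj (mor_id CW) (mor_id CW)).
rewrite [LHS]lext_bvec (eq_bigr (fun I : isub t => F (val I))) => [|I _]; last exact: bF.
rewrite -(big_sub [pred I : {set 'I_(size t)} | zeros t \subset I] F).
(* The set of all positions and the set of holes give the two unit terms. *)
rewrite (bigD1 [set: 'I_(size t)]) /=; last by rewrite inE subsetT.
have zT : zeros t != [set: 'I_(size t)].
  apply: contra ht => /eqP zT; apply/allP => x /(tnthP (in_tuple t))[i ->].
  by have := in_setT i; rewrite -zT inE.
rewrite (bigD1 (zeros t)) /=; last by rewrite inE subxx.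
rewrite addrA; congr (_ + _ + _).
- by rewrite eta_star bF /F restr_setT close_setT /wtext /= source_zword.
- by rewrite eta_star bF /F restr_zeros close_zeros /wtext /= source_zword.
pose wp : CWp t := bvec K (exist _ w ht : wordp SL SR t).
rewrite -[RHS]/(bmap incl incl t (Dprec SL SR K t wp + Dsucc SL SR K t wp)).
rewrite [Dprec _ _ _ t _]lext_bvec [Dsucc _ _ _ t _]lext_bvec.
rewrite -(bigID (fun I : psub t => neck_in (val I)) predT) /=.
rewrite (linear_sum (bmap incl incl t)) (eq_bigr (fun I : psub t => F (val I))); last first.
  move=> I _; rewrite bmap_bten /incl /= !lext_bvec; exact: bF.
rewrite -(big_sub [pred I : {set 'I_(size t)} |
  (zeros t \proper I) && (I \proper [set: 'I_(size t)])] F).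
apply: eq_bigl => I; rewrite !inE !properEneq subsetT andbT [zeros t == I]eq_sym.
by rewrite andbC andbA.
Qed.

End Counit.

Theorem theorem4p20
  (R : realType)
  (A : algType R[i]) (phi : {linear A -> R[i]^o}) (phi_unital : phi 1 = 1)
  (AL AR : {pred A})
  (AL_submod : GRing.submod_closed AL) (AL_mul : GRing.mulr_2closed AL)
  (AR_submod : GRing.submod_closed AR) (AR_mul : GRing.mulr_2closed AR)
  (SL SR : {fset A})
  (SL_sub : {subset SL <= AL}) (SR_sub : {subset SR <= AR}) :
  let CW := CW SL SR R[i] in
  let CWp := CWp SL SR R[i] in
  let Delta : mor CW (box CW CW) := Delta SL SR R[i] in
  let Dprec : mor CWp (box CWp CWp) := Dprec SL SR R[i] in
  let Dsucc : mor CWp (box CWp CWp) := Dsucc SL SR R[i] in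
  let Dbar : mor CWp (box CWp CWp) := Dbar SL SR R[i] in
  let eps : mor CW (unitc R[i]) := eps SL SR R[i] in
  let eta : mor (unitc R[i]) CW := eta SL SR R[i] in
  let incl : mor CWp CW := incl SL SR R[i] in
  [/\ (* (1) *)
      [/\ mor_eq (mor_comp (bmap eps (mor_id CW)) Delta) (lunit CW),
          mor_eq (mor_comp (bmap (mor_id CW) eps) Delta) (runit CW)
        & mor_eq (mor_comp eps eta) (mor_id (unitc R[i]))],
      (* (2) *)
      forall (t : tword) (ht : ~~ allzero t) (w : word SL SR t),
        let w' : CW t := bvec R[i] w in
        let wp : CWp t := bvec R[i] (exist _ w ht : wordp SL SR t) in
        Delta t w' =
          bten (is_comp_zwordr t) w' (eta _ (star R[i] (source t)))
          + bten (is_comp_zwordl t) (eta _ (star R[i] (target t))) w'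
          + bmap incl incl t (Dbar t wp),
      (* (3) *)
      [/\ mor_eq (mor_comp (assoc CWp CWp CWp) (mor_comp (bmap Dprec (mor_id CWp)) Dprec))
              (mor_comp (bmap (mor_id CWp) Dbar) Dprec),
          mor_eq (mor_comp (bmap (mor_id CWp) Dsucc) Dsucc)
              (mor_comp (assoc CWp CWp CWp) (mor_comp (bmap Dbar (mor_id CWp)) Dsucc))
        & mor_eq (mor_comp (assoc CWp CWp CWp) (mor_comp (bmap Dsucc (mor_id CWp)) Dprec))
              (mor_comp (bmap (mor_id CWp) Dprec) Dsucc)]
    & (* (4) *)
      forall (t : tword) (w : wordp SL SR t),
        exists n : nat, Dbar_pow SL SR R[i] n t (bvec R[i] w) = 0].
Proof.
move=> CW CWp Delta Dprec Dsucc Dbar eps eta incl; split.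
- split; [exact: counit_left | exact: counit_right | exact: counit_unit].
- by move=> t ht w; exact: Delta_reduced.
- split; [exact: unshuffle_prec | | exact: unshuffle_mixed].
  by move=> t x; rewrite -unshuffle_succ.
by move=> t w; exists (count snd t); apply: rpow_eq0; exact: leqnSn.
Qed.
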